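(* Let $f\in R[x^{\pm1}]$ with $v(f)=0$ be neither a square nor divisible by the square of a non-unit in $K[x^{\pm1}]$, and let $K(x,z)$ be the quadratic extension of $K(x)$ defined by $z^2=f$. Let $f=h^2+g$ be an optimal decomposition, put $\gamma:=\min\{2,w(f)\}$, and let $t\in K(x,z)$ be the element with $z=h+2^{\gamma/2}t$, so that $$2^{1-\gamma/2}ht+t^2=g/2^\gamma\qquad( * )$$ with coefficients in $R[x^{\pm1}]$. Then the normalization of $A:=R[x^{\pm1}]$ in $K(x,z)$ is flat over $R$ and isomorphic to $$B:=R[x^{\pm1}][t]\big/\bigl(2^{1-\gamma/2}ht+t^2-g/2^\gamma\bigr).$$ Moreover: (a) If $w(f)<2$, equation $( * )$ modulo $\mathfrak m$ has the form $t^2=[g/2^\gamma]$. The curve $\operatorname{Spec}B/\mathfrak mB$ is irreducible and is smooth over $k$ outside finitely many points where $[\frac{dg}{dx}/2^\gamma]=0$, and the double covering $\operatorname{Spec}B/\mathfrak mB\to\operatorname{Spec}A/\mathfrak mA$ is purely inseparable. (b) If $w(f)=2$, equation $( * )$ modulo $\mathfrak m$ has the form $[h]t+t^2=[g/4]$. The curve $\operatorname{Spec}B/\mathfrak mB$ is irreducible and is smooth over $k$ outside finitely many points where $[f]=0$, and the double covering $\operatorname{Spec}B/\mathfrak mB\to\operatorname{Spec}A/\mathfrak mA$ is separable. (c) If $w(f)>2$, equation $( * )$ modulo $\mathfrak m$ has the form $([h]+t)\cdot t=0$. The curve $\operatorname{Spec}B/\mathfrak mB$ is the union of two distinct rational curves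 and is smooth over $k$ outside finitely many points where $[f]=0$, and each irreducible component maps isomorphically to $\operatorname{Spec}A/\mathfrak mA$.
   Context: $R_1$ is a complete discrete valuation ring with quotient field $K_1$ of characteristic $0$ and residue field of characteristic $2$; $K$ is an algebraic closure of $K_1$; $R$ is the integral closure of $R_1$ in $K$, a valuation ring with $\mathbb Q$-valued valuation $v$ normalized by $v(2)=1$, maximal ideal $\mathfrak m$, and algebraically closed residue field $k=R/\mathfrak m$. A group homomorphism $\mathbb Q\to K^\times$, $\alpha\mapsto2^\alpha$, with $2^1=2$ is fixed, so $v(2^\alpha)=\alpha$. For $f=\sum_i a_ix^i\in K[x^{\pm1}]$ put $v(f):=\inf\{v(a_i)\mid i\in\mathbb Z\}$; for $f\in R[x^{\pm1}]$ let $[f]\in k[x^{\pm1}]$ denote its residue class modulo $\mathfrak m$. For $f\in R[x^{\pm1}]$ with $v(f)=0$ put $$w(f):=\sup\{v(f-h^2)\mid h\in R[x^{\pm1}]\}\in\mathbb R\cup\{\infty\}.$$ A decomposition $f=h^2+g$ with $g,h\in R[x^{\pm1}]$ is called optimal if $v(g)=w(f)$ or $v(g)>2$. (An optimal decomposition always exists.) *)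

(* Defs.v *)
From HB Require Import structures.
From mathcomp Require Import all_boot all_order all_algebra all_field.
From mathcomp Require Import finmap.
From mathcomp Require Import all_classical all_reals ereal.

Set Implicit Arguments.
Unset Strict Implicit.
Unset Printing Implicit Defensive.

Import Order.TTheory GRing.Theory Num.Theory.
Local Open Scope ring_scope.

(* S[x^{+-1}]: finitely supported families of coefficients indexed by int,
   with the convolution product. *)
Record laurent (S : comNzRingType) : predArgType :=
  Laurent { laurent_val : {fsfun int -> S with 0} }.

HB.instance Definition _ (S : comNzRingType) := [isNew for @laurent_val S].
HB.instance Definition _ (S : comNzRingType) := [Choice of laurent S by <:].
Bind Scope ring_scope with laurent.

Section LaurentZmod.
Variable S : comNzRingType.
Implicit Types (f g : laurent S) (i j k : int) (a b : S).

Definition lcoef k f : S := laurent_val f k.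
Definition lsupp f : {fset int} := finsupp (laurent_val f).
(* a x^k *)
Definition lmono k a : laurent S := Laurent [fsfun i in [fset k]%fset => a].
Definition lC a : laurent S := lmono 0 a.

Lemma laurentP f g : (forall k, lcoef k f = lcoef k g) <-> f = g.
Proof.
by case: f g => [f] [g]; split=> [h|->//]; congr Laurent; apply/fsfunP/h.
Qed.

Lemma lcoef_fset (d : {fset int}) (E : int -> S) k :
  lcoef k (Laurent [fsfun i in d => E i]) = if k \in d then E k else 0.
Proof. exact/fsfun_fun. Qed.

Lemma lcoef_out f k : k \notin lsupp f -> lcoef k f = 0.
Proof. exact: fsfun_dflt. Qed.

Lemma mem_lsupp f k : (k \in lsupp f) = (lcoef k f != 0).
Proof. by rewrite /lsupp mem_finsupp. Qed.

Definition lzero : laurent S := Laurent [fsfun].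
Definition lopp f := Laurent [fsfun k in lsupp f => - lcoef k f].
Definition ladd f g :=
  Laurent [fsfun k in (lsupp f `|` lsupp g)%fset => lcoef k f + lcoef k g].

Lemma lzeroE k : lcoef k lzero = 0.
Proof. by rewrite /lcoef /= fsfun_dflt // finsupp0. Qed.

Lemma loppE f k : lcoef k (lopp f) = - lcoef k f.
Proof.
by rewrite lcoef_fset; case: ifPn => // /lcoef_out ->; rewrite oppr0.
Qed.

Lemma laddE f g k : lcoef k (ladd f g) = lcoef k f + lcoef k g.
Proof.
rewrite lcoef_fset in_fsetU; case: ifPn => //.
by rewrite negb_or => /andP[/lcoef_out -> /lcoef_out ->]; rewrite addr0.
Qed.

Lemma laddA : associative ladd.
Proof. by move=> f g h; apply/laurentP=> k; rewrite !laddE addrA. Qed.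
Lemma laddC : commutative ladd.
Proof. by move=> f g; apply/laurentP=> k; rewrite !laddE addrC. Qed.
Lemma ladd0 : left_id lzero ladd.
Proof. by move=> f; apply/laurentP=> k; rewrite laddE lzeroE add0r. Qed.
Lemma laddN : left_inverse lzero lopp ladd.
Proof. by move=> f; apply/laurentP=> k; rewrite laddE loppE lzeroE addNr. Qed.

HB.instance Definition _ :=
  GRing.isZmodule.Build (laurent S) laddA laddC ladd0 laddN.

Lemma lcoef_is_zmod_morphism k : zmod_morphism (lcoef k).
Proof. by move=> f g /=; rewrite laddE loppE. Qed.
HB.instance Definition _ k :=
  GRing.isZmodMorphism.Build (laurent S) S (lcoef k)
    (lcoef_is_zmod_morphism k).

Lemma lcoefD k : {morph lcoef k : f g / f + g}. Proof. exact: raddfD. Qed.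
Lemma lcoef0 k : lcoef k 0 = 0. Proof. exact: (raddf0 (lcoef k)). Qed.
Lemma lcoef_sum k I (r : seq I) (F : I -> laurent S) :
  lcoef k (\sum_(i <- r) F i) = \sum_(i <- r) lcoef k (F i).
Proof. exact: (raddf_sum (lcoef k)). Qed.

Lemma lcoef_lmono k a i : lcoef i (lmono k a) = a *+ (i == k).
Proof. by rewrite lcoef_fset in_fset1; case: eqP. Qed.

Lemma lmono_is_zmod_morphism k : zmod_morphism (lmono k).
Proof.
move=> a b /=; apply/laurentP=> i.
by rewrite (raddfB (lcoef i)) /= !lcoef_lmono mulrnBl.
Qed.
HB.instance Definition _ k :=
  GRing.isZmodMorphism.Build S (laurent S) (lmono k)
    (lmono_is_zmod_morphism k).

Lemma lmono0 k : lmono k 0 = 0. Proof. exact: (raddf0 (lmono k)). Qed.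
Lemma lmonoD k : {morph lmono k : a b / a + b}. Proof. exact: raddfD. Qed.

Lemma lsupp_lmono k a : (lsupp (lmono k a) `<=` [fset k])%fset.
Proof.
apply/fsubsetP=> i; rewrite mem_lsupp lcoef_lmono in_fset1.
by case: (i == k); rewrite ?mulr0n ?eqxx.
Qed.

Lemma lsuppD f g : (lsupp (f + g) `<=` lsupp f `|` lsupp g)%fset.
Proof.
apply/fsubsetP=> k; rewrite in_fsetU !mem_lsupp lcoefD.
by apply: contraR; rewrite negb_or !negbK => /andP[/eqP-> /eqP->]; rewrite addr0.
Qed.

Lemma laurentEw (d : {fset int}) f : (lsupp f `<=` d)%fset ->
  f = \sum_(k <- d) lmono k (lcoef k f).
Proof.
move=> /fsubsetP sfd; apply/laurentP=> k; rewrite lcoef_sum.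
have [kd|kNd] := boolP (k \in d).
  rewrite (big_fsetD1 k) //= lcoef_lmono eqxx mulr1n big1_fset ?addr0 // => i.
  by rewrite in_fsetD1 lcoef_lmono eq_sym => /andP[/negPf -> _].
rewrite big1_fset => [|i id_ _].
  by apply/lcoef_out; apply: contra kNd => /sfd.
rewrite lcoef_lmono; case: eqP => // ki.
by rewrite ki id_ in kNd.
Qed.

Lemma laurentE f : f = \sum_(k <- lsupp f) lmono k (lcoef k f).
Proof. exact/laurentEw. Qed.

End LaurentZmod.

Section LaurentRing.
Variable S : comNzRingType.
Implicit Types (f g : laurent S) (i j k : int) (a b : S).

Definition lmul f g : laurent S :=
  \sum_(i <- lsupp f) \sum_(j <- lsupp g) lmono (i + j) (lcoef i f * lcoef j g).

Lemma lmulEw (d e : {fset int}) f g :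
  (lsupp f `<=` d)%fset -> (lsupp g `<=` e)%fset ->
  lmul f g = \sum_(i <- d) \sum_(j <- e) lmono (i + j) (lcoef i f * lcoef j g).
Proof.
move=> sfd sge; rewrite /lmul (big_fset_incl _ sfd) /=.
  apply/eq_bigr=> i _; apply/big_fset_incl => // j _ /lcoef_out ->.
  by rewrite mulr0 lmono0.
move=> i _ /lcoef_out fi0.
by rewrite big1 // => j _; rewrite fi0 mul0r lmono0.
Qed.

Lemma lmulC : commutative lmul.
Proof.
move=> f g; rewrite /lmul exchange_big; apply: eq_bigr => j _.
by apply: eq_bigr => i _; rewrite mulrC addrC.
Qed.

Lemma lmul_lmono a b i j : lmul (lmono i a) (lmono j b) = lmono (i + j) (a * b).
Proof.
rewrite (lmulEw (lsupp_lmono i a) (lsupp_lmono j b)) !big_seq_fset1.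
by rewrite !lcoef_lmono !eqxx.
Qed.

Lemma lmulDl : left_distributive lmul +%R.
Proof.
move=> f g h.
rewrite [in RHS](lmulEw (fsubsetUl _ (lsupp g)) (fsubset_refl _)).
rewrite [in RHS](lmulEw (fsubsetUr (lsupp f) _) (fsubset_refl _)).
rewrite (lmulEw (lsuppD _ _) (fsubset_refl _)) -big_split /=.
apply/eq_bigr=> i _; rewrite -big_split /=; apply/eq_bigr=> j _.
by rewrite lcoefD mulrDl lmonoD.
Qed.

Lemma lmulDr : right_distributive lmul +%R.
Proof. by move=> f g h; rewrite lmulC lmulDl !(lmulC f). Qed.

Lemma lmul0l f : lmul 0 f = 0.
Proof. by apply: (addrI (lmul 0 f)); rewrite -lmulDl !addr0. Qed.
Lemma lmul0r f : lmul f 0 = 0.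
Proof. by rewrite lmulC lmul0l. Qed.

Lemma lmul_suml I (r : seq I) (F : I -> laurent S) f :
  lmul (\sum_(i <- r) F i) f = \sum_(i <- r) lmul (F i) f.
Proof. exact: (big_morph (lmul^~ f) (fun _ _ => lmulDl _ _ _) (lmul0l f)). Qed.
Lemma lmul_sumr I (r : seq I) (F : I -> laurent S) f :
  lmul f (\sum_(i <- r) F i) = \sum_(i <- r) lmul f (F i).
Proof. exact: (big_morph (lmul f) (fun _ _ => lmulDr _ _ _) (lmul0r f)). Qed.

Lemma lmulA : associative lmul.
Proof.
move=> f g h; rewrite [f]laurentE !lmul_suml; apply: eq_bigr => i _.
rewrite [g]laurentE lmul_suml !lmul_sumr lmul_suml; apply: eq_bigr => j _.
rewrite [h]laurentE !lmul_sumr; apply: eq_bigr => k _.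
by rewrite !lmul_lmono mulrA addrA.
Qed.

Lemma lmul1 : left_id (lC 1) lmul.
Proof.
move=> f; rewrite [f in LHS]laurentE [RHS]laurentE lmul_sumr.
by apply: eq_bigr => k _; rewrite lmul_lmono mul1r add0r.
Qed.

Lemma lone_neq0 : lC 1 != 0 :> laurent S.
Proof.
apply/eqP=> /laurentP /(_ 0) /eqP.
by rewrite lcoef_lmono eqxx lcoef0 oner_eq0.
Qed.

HB.instance Definition _ := GRing.Zmodule_isComNzRing.Build (laurent S)
  lmulA lmulC lmul1 lmulDl lone_neq0.

Lemma lmonoM a b i j : lmono i a * lmono j b = lmono (i + j) (a * b).
Proof. exact: lmul_lmono. Qed.

Lemma lC_is_zmod_morphism : zmod_morphism (@lC S).
Proof. exact: lmono_is_zmod_morphism. Qed.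
Lemma lC_is_monoid_morphism : monoid_morphism (@lC S).
Proof. by split=> // a b; rewrite lmonoM addr0. Qed.
HB.instance Definition _ :=
  GRing.isZmodMorphism.Build S (laurent S) (@lC S) lC_is_zmod_morphism.
HB.instance Definition _ :=
  GRing.isMonoidMorphism.Build S (laurent S) (@lC S) lC_is_monoid_morphism.

Definition lderiv f : laurent S :=
  \sum_(k <- lsupp f) lmono (k - 1) (lcoef k f *~ k).

End LaurentRing.

(* The morphism S[x^{+-1}] -> T given by phi on S and x^k |-> h k. *)
Section LaurentEval.
Variables (S T : comNzRingType) (phi : {rmorphism S -> T}) (h : int -> T).

Definition lhom (f : laurent S) : T := \sum_(k <- lsupp f) phi (lcoef k f) * h k.

Lemma lhomEw (d : {fset int}) f : (lsupp f `<=` d)%fset ->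
  lhom f = \sum_(k <- d) phi (lcoef k f) * h k.
Proof.
move=> sfd; rewrite /lhom (big_fset_incl _ sfd) //= => k _ /lcoef_out ->.
by rewrite rmorph0 mul0r.
Qed.

Lemma lhom_lmono k a : lhom (lmono k a) = phi a * h k.
Proof.
by rewrite (lhomEw (lsupp_lmono k a)) big_seq_fset1 lcoef_lmono eqxx.
Qed.

Lemma lhom_is_zmod_morphism : zmod_morphism lhom.
Proof.
move=> f g; pose d := (lsupp f `|` lsupp g `|` lsupp (f - g))%fset.
have sf : (lsupp f `<=` d)%fset by rewrite /d -fsetUA fsubsetUl.
have sg : (lsupp g `<=` d)%fset by rewrite /d fsetUAC fsubsetUr.
have sfg : (lsupp (f - g) `<=` d)%fset by rewrite /d fsubsetUr.
rewrite (lhomEw sf) (lhomEw sg) (lhomEw sfg) -sumrB; apply: eq_bigr => k _.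
by rewrite (raddfB (@lcoef S k)) /= rmorphB mulrBl.
Qed.

Lemma lhom_is_monoid_morphism :
  h 0 = 1 -> {morph h : i j / i + j >-> i * j} -> monoid_morphism lhom.
Proof.
move=> h0 hD; split=> [|f g]; first by rewrite lhom_lmono rmorph1 mul1r h0.
pose ladd := GRing.isZmodMorphism.Build _ _ lhom lhom_is_zmod_morphism.
pose lh : {additive laurent S -> T} := HB.pack lhom ladd.
have lhs I (r : seq I) (F : I -> laurent S) :
  lhom (\sum_(i <- r) F i) = \sum_(i <- r) lhom (F i).
  exact: (raddf_sum lh).
rewrite [f * g]/(lmul f g) /lmul lhs /lhom mulr_suml; apply: eq_bigr => i _.
rewrite -[X in X = _]/(lhom _) lhs mulr_sumr; apply: eq_bigr => j _.
by rewrite lhom_lmono rmorphM hD mulrACA.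
Qed.
End LaurentEval.

(* Coefficientwise extension of phi : S -> T to S[x^{+-1}] -> T[x^{+-1}]. *)
Section LaurentMap.
Variables (S T : comNzRingType) (phi : {rmorphism S -> T}).

Definition lmap : laurent S -> laurent T :=
  lhom (@lC T \o phi) (fun k => lmono k 1).

HB.instance Definition _ := GRing.isZmodMorphism.Build _ _ lmap
  (lhom_is_zmod_morphism (@lC T \o phi) (fun k => lmono k 1)).
Lemma lmap_is_monoid_morphism : monoid_morphism lmap.
Proof.
by apply: lhom_is_monoid_morphism => // i j; rewrite lmonoM mulr1.
Qed.
HB.instance Definition _ :=
  GRing.isMonoidMorphism.Build _ _ lmap lmap_is_monoid_morphism.

Lemma lcoef_lmap f k : lcoef k (lmap f) = phi (lcoef k f).
Proof.
rewrite {1}/lmap /lhom lcoef_sum [f in RHS]laurentE lcoef_sum rmorph_sum /=.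
apply: eq_bigr => i _; rewrite lmonoM mulr1 add0r.
by rewrite !lcoef_lmono rmorphMn.
Qed.
End LaurentMap.

Section LaurentFrac.
Variable F : fieldType.

Definition lfrac : laurent F -> {fraction {poly F}} :=
  lhom (@tofrac {poly F} \o polyC) (fun k => (tofrac 'X) ^ k).

HB.instance Definition _ := GRing.isZmodMorphism.Build _ _ lfrac
  (lhom_is_zmod_morphism (@tofrac {poly F} \o polyC) (fun k => (tofrac 'X) ^ k)).
Lemma lfrac_is_monoid_morphism : monoid_morphism lfrac.
Proof.
apply: lhom_is_monoid_morphism => [|i j]; first by rewrite expr0z.
by rewrite expfzDr // tofrac_eq0 polyX_eq0.
Qed.
HB.instance Definition _ :=
  GRing.isMonoidMorphism.Build _ _ lfrac lfrac_is_monoid_morphism.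
End LaurentFrac.

Section IntClosure.
Variables (A : comNzRingType) (K : fieldType) (phi : {rmorphism A -> K}).

Definition int_closure_pred : {pred K} := fun u => `[< integralOver phi u >].

Lemma int_closure_subring : subring_closed int_closure_pred.
Proof.
split; first exact/asboolP/integral1.
- by move=> u u' /asboolP ? /asboolP ?; apply/asboolP/integral_sub.
- by move=> u u' /asboolP ? /asboolP ?; apply/asboolP/integral_mul.
Qed.
HB.instance Definition _ :=
  GRing.isSubringClosed.Build K int_closure_pred int_closure_subring.

Record int_closure : predArgType :=
  IntClosure { ic_val : K; _ : ic_val \in int_closure_pred }.
HB.instance Definition _ := [isSub for ic_val].
HB.instance Definition _ := [Choice of int_closure by <:].
HB.instance Definition _ := [SubChoice_isSubComNzRing of int_closure by <:].

Definition ic_in (a : A) : int_closure :=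
  IntClosure (asboolT (integral_id phi a) : phi a \in int_closure_pred).

Lemma ic_in_is_zmod_morphism : zmod_morphism ic_in.
Proof. by move=> a b; apply: val_inj; rewrite /= rmorphB. Qed.
Lemma ic_in_is_monoid_morphism : monoid_morphism ic_in.
Proof. by split=> [|a b]; apply: val_inj; rewrite /= (rmorph1, rmorphM). Qed.
HB.instance Definition _ :=
  GRing.isZmodMorphism.Build A int_closure ic_in ic_in_is_zmod_morphism.
HB.instance Definition _ :=
  GRing.isMonoidMorphism.Build A int_closure ic_in ic_in_is_monoid_morphism.
End IntClosure.

Section IntClosureVal.
Variables (A : comNzRingType) (K : fieldType) (phi : {rmorphism A -> K}).
Local Notation O := (int_closure phi).

Lemma ic_val_is_zmod_morphism : zmod_morphism (@ic_val A K phi).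
Proof. by []. Qed.
Lemma ic_val_is_monoid_morphism : monoid_morphism (@ic_val A K phi).
Proof. by []. Qed.
HB.instance Definition _ :=
  GRing.isZmodMorphism.Build O K (@ic_val A K phi) ic_val_is_zmod_morphism.
HB.instance Definition _ :=
  GRing.isMonoidMorphism.Build O K (@ic_val A K phi) ic_val_is_monoid_morphism.
End IntClosureVal.

(* S/(E), for (E) the ideal generated by a subset E of S.  The library's
   {ideal_quot _} requires a proper ideal; here the zero ring is allowed. *)
Section QuotientRing.
Local Open Scope quotient_scope.
Variables (S : comPzRingType) (E : set S).

Definition ideal_gen : {pred S} := fun s =>
  `[< exists r : seq (S * S), (forall p, p \in r -> E p.2) /\
        s = \sum_(p <- r) p.1 * p.2 >].

Lemma ideal_gen_zmod : zmod_closed ideal_gen.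
Proof.
split; first by apply/asboolP; exists [::]; rewrite big_nil.
move=> x y /asboolP[r [rE ->]] /asboolP[r' [r'E ->]]; apply/asboolP.
exists (r ++ [seq (- p.1, p.2) | p <- r']); split.
  by move=> p; rewrite mem_cat => /orP[/rE//|/mapP[q /r'E qE ->]].
rewrite big_cat big_map /= -sumrN; congr (_ + _).
by apply: eq_bigr => p _; rewrite mulNr.
Qed.
HB.instance Definition _ :=
  GRing.isZmodClosed.Build S ideal_gen ideal_gen_zmod.

Lemma ideal_genMl a x : x \in ideal_gen -> a * x \in ideal_gen.
Proof.
move=> /asboolP[r [rE ->]]; apply/asboolP.
exists [seq (a * p.1, p.2) | p <- r]; split.
  by move=> p /mapP[q /rE qE ->].
by rewrite big_map mulr_sumr; apply: eq_bigr => p _; rewrite mulrA.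
Qed.

Definition quotient : Type := {ideal_quot ideal_gen}.
HB.instance Definition _ := GRing.Zmodule.on quotient.

Definition quot_pi (s : S) : quotient := \pi_({ideal_quot ideal_gen}) s.
Definition quot_mul (x y : quotient) : quotient :=
  quot_pi (repr (x : {ideal_quot ideal_gen}) * repr (y : {ideal_quot ideal_gen})).

Lemma quot_piE x y : quot_pi x = quot_pi y <-> x - y \in ideal_gen.
Proof. by rewrite Quotient.idealrBE; split=> [/eqP|/eqP]. Qed.

Lemma quot_pi_repr (x : quotient) : quot_pi (repr (x : {ideal_quot ideal_gen})) = x.
Proof. exact: reprK. Qed.

Lemma quot_pi_is_zmod_morphism : zmod_morphism quot_pi.
Proof. by move=> x y; rewrite /quot_pi !piE. Qed.

Lemma quot_piM x y : quot_pi (x * y) = quot_mul (quot_pi x) (quot_pi y).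
Proof.
apply/quot_piE; set x' := repr _; set y' := repr _.
have xx' : x - x' \in ideal_gen by apply/quot_piE; rewrite quot_pi_repr.
have yy' : y - y' \in ideal_gen by apply/quot_piE; rewrite quot_pi_repr.
have -> : x * y - x' * y' = y * (x - x') + x' * (y - y').
  by rewrite !mulrBr [y * x]mulrC [y * x']mulrC addrA subrK.
by rewrite rpredD // ideal_genMl.
Qed.

Lemma quot_mulA : associative quot_mul.
Proof.
move=> x y z; rewrite -[x]quot_pi_repr -[y]quot_pi_repr -[z]quot_pi_repr.
by rewrite -!quot_piM mulrA.
Qed.
Lemma quot_mulC : commutative quot_mul.
Proof. by move=> x y; rewrite /quot_mul mulrC. Qed.
Lemma quot_mul1 : left_id (quot_pi 1) quot_mul.
Proof. by move=> x; rewrite -[x]quot_pi_repr -quot_piM mul1r. Qed.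
Lemma quot_mulDl : left_distributive quot_mul +%R.
Proof.
move=> x y z; rewrite -[x]quot_pi_repr -[y]quot_pi_repr -[z]quot_pi_repr.
have piD a b : quot_pi a + quot_pi b = quot_pi (a + b) by rewrite /quot_pi !piE.
by rewrite piD -!quot_piM mulrDl piD.
Qed.

HB.instance Definition _ := GRing.Zmodule_isComPzRing.Build quotient
  quot_mulA quot_mulC quot_mul1 quot_mulDl.

HB.instance Definition _ :=
  GRing.isZmodMorphism.Build S quotient quot_pi quot_pi_is_zmod_morphism.
Lemma quot_pi_is_monoid_morphism : monoid_morphism quot_pi.
Proof. by split=> // x y; rewrite quot_piM. Qed.
HB.instance Definition _ :=
  GRing.isMonoidMorphism.Build S quotient quot_pi quot_pi_is_monoid_morphism.
End QuotientRing.

(* A is a discrete valuation ring with valuation ord, complete in the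
   ord-adic topology. *)
Definition complete_dvr (A : idomainType) : Prop :=
  exists ord : {fraction A} -> int,
  let close (N : int) (a b : A) := a = b \/ N <= ord (tofrac (a - b)) in
  [/\ forall x y, x != 0 -> y != 0 -> ord (x * y) = ord x + ord y,
      forall x y, x != 0 -> y != 0 -> x + y != 0 ->
        Num.min (ord x) (ord y) <= ord (x + y),
      exists2 x, x != 0 & ord x = 1,
      forall x, x != 0 -> (0 <= ord x <-> exists a, x = tofrac a) &
      forall s : nat -> A,
        (forall N, exists n0, forall m n,
           (n0 <= m)%N -> (n0 <= n)%N -> close N (s m) (s n)) ->
        exists l, forall N, exists n0, forall n, (n0 <= n)%N -> close N (s n) l].

Section Valuation.
Variables (RR : realType) (K : fieldType) (v : K -> \bar RR).
Local Open Scope ereal_scope.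

Definition is_rat_valuation : Prop :=
  [/\ v 0%R = +oo,
      forall x, x != 0%R -> exists q : rat, v x = (ratr q)%:E,
      forall x y, v (x * y)%R = v x + v y &
      forall x y, mine (v x) (v y) <= v (x + y)%R].

Definition gauss_val (f : laurent K) : \bar RR :=
  ereal_inf [set v (lcoef i f) | i in [set: int]].

Variables (R : comNzRingType) (j : {rmorphism R -> K}).

Definition lval (f : laurent R) : \bar RR := gauss_val (lmap j f).

Definition wval (f : laurent R) : \bar RR :=
  ereal_sup [set lval (f - h ^+ 2)%R | h in [set: laurent R]].

Definition optimal_decomposition (f h g : laurent R) : Prop :=
  f = (h ^+ 2 + g)%R /\ (lval g = wval f \/ 2%:E < lval g).
End Valuation.

Section ToL.
Variables (R : comNzRingType) (K : fieldType) (j : {rmorphism R -> K}).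
Variable L : fieldExtType {fraction {poly K}}.

Definition toL : laurent R -> L := in_alg L \o (@lfrac K \o lmap j).
HB.instance Definition _ := GRing.RMorphism.on toL.

(* b = c a, where a and b have coefficients in R and c lies in K *)
Definition lscaled (c : K) (a b : laurent R) : Prop :=
  lmap j b = lC c * lmap j a.
End ToL.

Definition quad_poly (S : comNzRingType) (a b : S) : {poly S} :=
  'X^2 + a%:P * 'X - b%:P.

(* Flatness of N as an R-module via phi.  By the universal property of the
   tensor product, an element \sum m_i (x) n_i of M (x)_R N is zero iff all
   balanced biadditive maps into abelian groups kill it. *)
Section Flat.
Variables (R N : comNzRingType) (phi : {rmorphism R -> N}).

Definition balanced (M : lmodType R) (P : zmodType) (beta : M -> N -> P) :=
  [/\ forall m m' n, beta (m + m') n = beta m n + beta m' n,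
      forall m n n', beta m (n + n') = beta m n + beta m n' &
      forall r m n, beta (r *: m) n = beta m (phi r * n)].

Definition tensor_eq0 (M : lmodType R) (s : seq (M * N)) : Prop :=
  forall (P : zmodType) (beta : M -> N -> P), balanced beta ->
    \sum_(p <- s) beta p.1 p.2 = 0.

Definition flat : Prop :=
  forall (M M' : lmodType R) (u : {linear M' -> M}), injective u ->
  forall s : seq (M' * N),
    tensor_eq0 [seq (u p.1, p.2) | p <- s] -> tensor_eq0 s.
End Flat.

Section Spec.
Variable C : comPzRingType.

Definition prime_ideal (P : set C) : Prop :=
  [/\ P 0, forall a b, P a -> P b -> P (a + b), forall a b, P b -> P (a * b),
      ~ P 1 & forall a b, P (a * b) -> P a \/ P b].

Record spec := Spec { spec_val :> set C; _ : prime_ideal spec_val }.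

Definition vanishing (E : set C) : set spec :=
  [set P | E `<=` spec_val P]%classic.

Definition zariski_closed (Z : set spec) : Prop := exists E, Z = vanishing E.

Definition irreducible (Z : set spec) : Prop :=
  (Z !=set0)%classic /\
  forall Z1 Z2, zariski_closed Z1 -> zariski_closed Z2 ->
    (Z `<=` Z1 `|` Z2)%classic -> (Z `<=` Z1)%classic \/ (Z `<=` Z2)%classic.

Definition irreducible_component (Z : set spec) : Prop :=
  [/\ zariski_closed Z, irreducible Z &
      forall Z', irreducible Z' -> (Z `<=` Z')%classic -> Z' = Z].
End Spec.

Section Smooth.
Variables (k : fieldType) (C : comPzRingType) (kappa : {rmorphism k -> C}).

Definition finite_type : Prop :=
  exists s : seq C, forall D : set C,
    (forall c, D (kappa c)) -> (forall x, x \in s -> D x) ->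
    (forall x y, D x -> D y -> D (x + y)) ->
    (forall x y, D x -> D y -> D (x * y)) -> forall x, D x.

(* Formal smoothness of the localization C_d over k: a morphism from C_d is a
   morphism from C inverting d, and a lift along a square-zero extension
   inverts d automatically. *)
Definition formally_smooth_on (d : C) : Prop :=
  forall (T T' : comPzRingType) (q : {rmorphism T -> T'})
         (s : {rmorphism k -> T}) (u : {rmorphism C -> T'}),
    (forall y, exists x, q x = y) ->
    (forall a b, q a = 0 -> q b = 0 -> a * b = 0) ->
    (forall c, u (kappa c) = q (s c)) ->
    (exists e, u d * e = 1) ->
    exists u' : {rmorphism C -> T},
      (forall c, u' (kappa c) = s c) /\ (forall x, q (u' x) = u x).

(* Spec C -> Spec k is smooth at P: some principal open neighbourhood of P is
   formally smooth and of finite presentation (equivalently, k being a field,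
   of finite type). *)
Definition smooth_at (P : spec C) : Prop :=
  finite_type /\ exists2 d, ~ spec_val P d & formally_smooth_on d.

Definition smooth_outside_finite_zeros (d : C) : Prop :=
  finite_set [set P : spec C | spec_val P d]%classic /\
  forall P : spec C, ~ spec_val P d -> smooth_at P.
End Smooth.

Section Covering.
Variables (k : fieldType) (C : comPzRingType).
Variable sigma : {rmorphism laurent k -> C}.

(* sigma is the ring map of a morphism Spec C -> Spec k[x^{+-1}]. *)
Definition module_finite : Prop :=
  exists (n : nat) (e : 'I_n -> C), forall x, exists c : 'I_n -> laurent k,
    x = \sum_i sigma (c i) * e i.

(* M, with jota : C -> M, is the function field of the integral curve Spec C,
   as an extension of the function field k(x) of Spec k[x^{+-1}]. *)
Definition function_field (M : fieldExtType {fraction {poly k}})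
    (jota : {rmorphism C -> M}) : Prop :=
  [/\ injective jota,
      forall a, jota (sigma a) = (lfrac a)%:A &
      forall y, exists a b, jota b != 0 /\ y = jota a / jota b].

Definition double_covering (ext : forall M : fieldExtType {fraction {poly k}},
    {vspace M} -> {vspace M} -> bool) : Prop :=
  module_finite /\
  exists (M : fieldExtType {fraction {poly k}}) (jota : {rmorphism C -> M}),
    [/\ function_field jota, \dim {:M} = 2 & ext M 1%VS fullv].

Definition purely_inseparable_double_covering : Prop :=
  double_covering (fun M => @purely_inseparable _ M).

Definition separable_double_covering : Prop :=
  double_covering (fun M => @separable _ M).

(* The function field of V(P), i.e. the residue field at P, is k-isomorphic to
   k(x). *)
Definition rational_curve (P : spec C) : Prop :=
  exists jota : {rmorphism C -> {fraction {poly k}}},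
    [/\ forall c, jota (sigma (lC c)) = tofrac c%:P,
        forall x, jota x = 0 <-> spec_val P x &
        forall y, exists a b, jota b != 0 /\ y = jota a / jota b].

(* V(P), with its reduced structure, maps isomorphically to Spec k[x^{+-1}]. *)
Definition component_iso (P : spec C) : Prop :=
  bijective (fun a => @quot_pi C (spec_val P) (sigma a)).

(* Spec C is the union of the closures of P1 and P2, which are its irreducible
   components. *)
Definition two_rational_curves (P1 P2 : spec C) : Prop :=
  [/\ P1 <> P2,
      (vanishing P1 `|` vanishing P2)%classic = setT,
      forall Z, irreducible_component Z <-> Z = vanishing P1 \/ Z = vanishing P2,
      rational_curve P1 & rational_curve P2].
End Covering.

(* The integral closure R of R1 in K, where iota : Frac(R1) -> K. *)
Notation "''O_' iota" := (int_closure (iota \o @tofrac _))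
  (at level 8, iota at level 2, format "''O_' iota").

(* With mm the maximal ideal of R and k = R/mm, model is
   B = R[x^{+-1}][T]/(T^2 + a T - b), and model_fiber is B/mm B.  The ring
   R[x^{+-1}]/mm is identified with k[x^{+-1}] by reducing coefficients. *)
Section Model.
Variables (R : comNzRingType) (mm : set R) (a b : laurent R).

Definition model := {poly %/ quad_poly a b}.
HB.instance Definition _ := GRing.ComNzRing.on model.

Definition model_in (c : laurent R) : model := qpolyC (quad_poly a b) c.
Definition model_T : model := 'qX.

Definition model_fiber :=
  @quotient model [set model_in (lC r) | r in mm]%classic.
HB.instance Definition _ := GRing.ComPzRing.on model_fiber.

Definition fiber_in (c : laurent R) : model_fiber := quot_pi _ (model_in c).
End Model.

(* Main.v *)
(* The reduced equation decides everything.  Any solution of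
   s^2 + [h'] s = [g'] in k[x^{+-1}] lifts to a better square approximation
   h + 2^(gamma/2) s of f, so for w(f) <= 2 optimality makes T^2 + [h'] T - [g']
   irreducible over k(x).  Normality: an element y = a + b t of K(x,z) integral
   over R[x^{+-1}] has integral trace and norm; as f is squarefree, a and b lie
   in K[x^{+-1}].  If they were not integral, dividing by the coefficient of
   smallest valuation would give residues, not both zero, of norm zero and with
   [b] [h'] = 0, which the reduced equation excludes.  Hence the normalization
   is free with basis 1, t, and so is its special fibre over k[x^{+-1}].
   Smoothness follows from the Jacobian criterion: in characteristic 2 the
   partial derivatives of T^2 + [h'] T - [g'] are [h'] in T, and the derivative
   of -[g'] in x when [h'] = 0. *)

Require Import Defs.
From HB Require Import structures.
From mathcomp Require Import all_boot all_order all_algebra all_field.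
From mathcomp Require Import finmap.
From mathcomp Require Import all_classical all_reals ereal.
From mathcomp Require Import ring.

Set Implicit Arguments.
Unset Strict Implicit.
Unset Printing Implicit Defensive.

Import Order.TTheory GRing.Theory Num.Theory.
Local Open Scope ring_scope.

(** * Laurent polynomials *)

(** [R] has value group Q, so it is not Noetherian and has no uniformizer, and normality cannot be
    tested in codimension one. Finiteness of supports takes over: the coefficients of finitely many
    Laurent polynomials attain a least valuation, and dividing by such a coefficient leaves integral
    coefficients with a nonzero residue. The model [B], the normalization and the special fibre are
    all treated through one notion, [quad_alg]; morphisms, flatness, function fields and points are
    derived from it once. For w(f) < 2 the exponent 1 - gamma/2 is positive, so [h'] = 0; for w(f)
    >= 2 one has gamma = 2, h' = h and [f] = [h]^2 nonzero, which is why [f] = 0 is the exceptional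
    locus in both (b) and (c). In (a) the locus is finite because [k] is perfect: a Laurent
    polynomial over [k] with zero derivative is a square, and [g'] is none. *)

Section LaurentPolynomials.
Variable S : comNzRingType.
Implicit Types (f g : laurent S) (p : {poly S}).

Local Notation x := (lmono 1 1 : laurent S).

Lemma lmonoXn n : x ^+ n = lmono n%:Z 1.
Proof.
elim: n => [|n IHn]; first by rewrite expr0.
by rewrite exprS IHn lmonoM mulr1 -intS.
Qed.

Lemma lmonoK k : lmono k 1 * lmono (- k) 1 = 1 :> laurent S.
Proof. by rewrite lmonoM subrr mulr1. Qed.

Lemma lmono_lC k (a : S) : lmono k a = lC a * lmono k 1.
Proof. by rewrite lmonoM add0r mulr1. Qed.

Lemma lcoef_lCM k a f : lcoef k (lC a * f) = a * lcoef k f.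
Proof.
rewrite [f in LHS]laurentE mulr_sumr lcoef_sum.
rewrite [f in RHS]laurentE lcoef_sum mulr_sumr; apply: eq_bigr => i _.
by rewrite lmonoM add0r !lcoef_lmono mulrnAr.
Qed.

Definition lpoly : {poly S} -> laurent S := horner_eval x \o map_poly (@lC S).
HB.instance Definition _ := GRing.RMorphism.on lpoly.

Lemma lpolyC a : lpoly a%:P = lC a.
Proof. by rewrite /lpoly /= map_polyC /horner_eval hornerC. Qed.

Lemma lpolyX : lpoly 'X = x.
Proof. by rewrite /lpoly /= map_polyX /horner_eval hornerX. Qed.

Lemma lpolyXn n : lpoly 'X^n = lmono n%:Z 1.
Proof. by rewrite rmorphXn /= lpolyX lmonoXn. Qed.

(** Since x is a unit, clearing denominators costs only a power of x; gcds, Bezout relations and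
    factorizations then come from ordinary polynomials. *)
Lemma laurent_poly f : exists n p, f = lmono (- n%:Z) 1 * lpoly p.
Proof.
rewrite [f]laurentE; apply: (@big_ind _ (fun f => exists n p, f = lmono (- n%:Z) 1 * lpoly p)) => [|f1 f2 [n1 [p1 ->]] [n2 [p2 ->]]|k _].
- by exists 0%N, 0; rewrite [lpoly 0]rmorph0 mulr0.
- exists (n1 + n2)%N, (p1 * 'X^n2 + p2 * 'X^n1).
  rewrite [lpoly (_ + _)]rmorphD /= [lpoly (p1 * _)]rmorphM [lpoly (p2 * _)]rmorphM /= !lpolyXn PoszD opprD.
  have -> : lmono (- n1%:Z - n2%:Z) 1 = lmono (- n1%:Z) 1 * lmono (- n2%:Z) 1 :> laurent S.
    by rewrite lmonoM mulr1.
  move: (lmonoK n1) (lmonoK n2) (lpoly p1) (lpoly p2).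
  move: (lmono n1 1) (lmono (- n1%:Z) 1) (lmono n2 1) (lmono (- n2%:Z) 1) => a a' b b' aa bb q1 q2.
  have -> : a' * q1 + b' * q2 = (b * b') * (a' * q1) + (a * a') * (b' * q2) by rewrite aa bb !mul1r.
  by ring.
- case: k => n.
    exists 0%N, ((lcoef n f)%:P * 'X^n).
    by rewrite [lpoly _]rmorphM /= lpolyXn lpolyC mul1r lmono_lC.
  exists n.+1, (lcoef (Negz n) f)%:P.
  by rewrite lpolyC mulrC lmono_lC NegzE.
Qed.

Lemma lcoef_lderiv k f : lcoef k (lderiv f) = lcoef (k + 1) f *~ (k + 1).
Proof.
rewrite /lderiv lcoef_sum [f in RHS]laurentE lcoef_sum mulrz_suml.
apply: eq_bigr => i _; rewrite !lcoef_lmono eq_sym subr_eq eq_sym.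
by case: eqP => [->|]; rewrite ?mulr1n ?mulr0n ?mul0rz.
Qed.

Lemma lderiv_is_zmod_morphism : zmod_morphism (@lderiv S).
Proof.
move=> f g; apply/laurentP=> k.
by rewrite (raddfB (lcoef k)) /= !lcoef_lderiv (raddfB (lcoef _)) mulrzBl.
Qed.
HB.instance Definition _ :=
  GRing.isZmodMorphism.Build (laurent S) (laurent S) (@lderiv S)
    lderiv_is_zmod_morphism.

Lemma lderiv_lmono k a : lderiv (lmono k a) = lmono (k - 1) (a *~ k) :> laurent S.
Proof.
apply/laurentP=> i; rewrite lcoef_lderiv !lcoef_lmono eq_sym -subr_eq eq_sym.
by case: eqP => [->|]; rewrite ?subrK ?mulr1n ?mulr0n ?mul0rz.
Qed.

Lemma lderivM f g : lderiv (f * g) = lderiv f * g + f * lderiv g.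
Proof.
have addl f1 f2 g1 : lderiv (f1 * g1) = lderiv f1 * g1 + f1 * lderiv g1 ->
    lderiv (f2 * g1) = lderiv f2 * g1 + f2 * lderiv g1 ->
  lderiv ((f1 + f2) * g1) = lderiv (f1 + f2) * g1 + (f1 + f2) * lderiv g1.
  by move=> e1 e2; rewrite mulrDl !(raddfD (@lderiv S)) /= e1 e2 !mulrDl addrACA.
have d0l g1 : lderiv (0 * g1) = lderiv 0 * g1 + 0 * lderiv g1.
  by rewrite !mul0r (raddf0 (@lderiv S)) mul0r addr0.
rewrite [f]laurentE.
apply: (@big_ind _ (fun f => lderiv (f * g) = lderiv f * g + f * lderiv g)) => //.
  by move=> f1 f2; apply: addl.
move=> i _; rewrite mulrC [RHS]addrC ![lmono _ _ * _]mulrC [lderiv _ * g]mulrC.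
rewrite [g]laurentE.
apply: (@big_ind _ (fun g => lderiv (g * lmono i (lcoef i f)) =
  lderiv g * lmono i (lcoef i f) + g * lderiv (lmono i (lcoef i f)))) => //.
  by move=> f1 f2; apply: addl.
move=> l _; rewrite lmonoM !lderiv_lmono !lmonoM.
rewrite [l - 1 + i]addrAC addrA -lmonoD; congr lmono.
by rewrite mulrzDr mulrzAl mulrzAr addrC.
Qed.

Lemma lderivC a : lderiv (lC a) = 0 :> laurent S.
Proof. by rewrite lderiv_lmono mulr0z lmono0. Qed.

End LaurentPolynomials.

Section LaurentMapTheory.
Variables (S T : comNzRingType) (phi : {rmorphism S -> T}).

Lemma lmap_lmono k a : lmap phi (lmono k a) = lmono k (phi a).
Proof. by apply/laurentP => i; rewrite lcoef_lmap !lcoef_lmono rmorphMn. Qed.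

Lemma lmap_lderiv f : lmap phi (lderiv f) = lderiv (lmap phi f).
Proof.
by apply/laurentP => i; rewrite lcoef_lmap !lcoef_lderiv lcoef_lmap rmorphMz.
Qed.

Lemma lmap_surj : (forall c, exists r, phi r = c) ->
  forall b, exists a, lmap phi a = b.
Proof.
move=> /choice[lift liftK] b; exists (\sum_(k <- lsupp b) lmono k (lift (lcoef k b))).
rewrite rmorph_sum [RHS]laurentE; apply: eq_bigr => i _.
by rewrite /= lmap_lmono liftK.
Qed.

Lemma lmap_inj : injective phi -> injective (lmap phi).
Proof.
move=> phiI a b /laurentP ab; apply/laurentP => k; apply: phiI.
by rewrite -!lcoef_lmap ab.
Qed.

End LaurentMapTheory.

(** The target may be the zero ring, because the test rings of formal smoothness are arbitrary;
    [lhom] has a nonzero target, so that case is treated apart. *)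
Lemma laurent_univ (S : comNzRingType) (T : comPzRingType)
    (s : {rmorphism S -> T}) (xi eta : T) : xi * eta = 1 ->
  exists psi : {rmorphism laurent S -> T},
    (forall c, psi (lC c) = s c) /\ psi (lmono 1 1) = xi.
Proof.
move=> xieta; case: (eqVneq (1 : T) 0) => [T0 | Tn0].
  have all0 (a b : T) : a = b by rewrite -[a]mulr1 -[b]mulr1 T0 !mulr0.
  pose fadd := GRing.isZmodMorphism.Build (laurent S) T (fun=> 0) (fun _ _ => all0 _ _).
  pose fmul := GRing.isMonoidMorphism.Build (laurent S) T (fun=> 0)
    (conj (all0 _ _) (fun _ _ => all0 _ _)).
  pose psi : {rmorphism laurent S -> T} := HB.pack (fun=> 0 : T) fadd fmul.
  by exists psi.
pose Tnz := GRing.PzSemiRing_isNonZero.Build T Tn0.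
pose T' : comNzRingType := HB.pack T Tnz.
pose s' : {rmorphism S -> T'} := s.
pose h (k : int) : T' := match k with Posz n => xi ^+ n | Negz n => eta ^+ n.+1 end.
have xe n : xi ^+ n * eta ^+ n = 1 by rewrite -exprMn xieta expr1n.
(* Every integer is a difference m - n of naturals, and in the form xi^m eta^n multiplicativity of
   [h] needs no distinction of signs. *)
have hsub m n : h (m%:Z - n%:Z) = xi ^+ m * eta ^+ n.
  have [nm|/ltnW mn] := leqP n m.
    by rewrite subzn //= -{2}(subnK nm) exprD -mulrA xe mulr1.
  rewrite -[LHS]/(h _) -opprB subzn // -{2}(subnKC mn) exprD mulrA xe mul1r.
  by case: (n - m)%N => [|d] //; rewrite -NegzE.
have h0 : h 0 = 1 by [].
have hD : {morph h : i l / i + l >-> i * l}.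
  move=> i l.
  have intsub (n : int) : exists a b : nat, n = a%:Z - b%:Z.
    by case: n => n; [exists n, 0; rewrite subr0 | exists 0, n.+1; rewrite sub0r NegzE].
  have [[a [b ->]] [c [d ->]]] := (intsub i, intsub l).
  have -> : a%:Z - b%:Z + (c%:Z - d%:Z) = (a + c)%N%:Z - (b + d)%N%:Z.
    by rewrite !PoszD opprD addrACA.
  by rewrite !hsub !exprD; rewrite [LHS]mulrACA.
pose fadd := GRing.isZmodMorphism.Build (laurent S) T' (lhom s' h)
  (lhom_is_zmod_morphism s' h).
pose fmul := GRing.isMonoidMorphism.Build (laurent S) T' (lhom s' h)
  (lhom_is_monoid_morphism s' h0 hD).
pose psi : {rmorphism laurent S -> T'} := HB.pack (lhom s' h) fadd fmul.
exists (psi : {rmorphism laurent S -> T}); split=> [c|] /=.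
  by rewrite lhom_lmono h0 mulr1.
by rewrite lhom_lmono rmorph1 mul1r.
Qed.

Section QuadPoly.
Variables (S T : comNzRingType) (phi : {rmorphism S -> T}).

Lemma map_quad_poly (a b : S) : map_poly phi (quad_poly a b) = quad_poly (phi a) (phi b).
Proof. by rewrite rmorphB rmorphD rmorphXn rmorphM /= map_polyX !map_polyC. Qed.

Lemma horner_quad_poly (a b u : S) : (quad_poly a b).[u] = u ^+ 2 + a * u - b.
Proof. by rewrite /quad_poly !hornerE. Qed.

Lemma size_quad_poly (a b : S) : size (quad_poly a b) = 3.
Proof.
rewrite /quad_poly -addrA size_polyDl size_polyXn // ltnS -polyCN.
rewrite (leq_trans (size_polyD _ _)) // geq_max (leq_trans (size_polyC_leq1 _)) // andbT.
by rewrite (leq_trans (size_polyMleq _ _)) // size_polyX addn2 /= ltnS size_polyC_leq1.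
Qed.

Lemma quad_poly_monic (a b : S) : quad_poly a b \is monic.
Proof.
rewrite monicE /lead_coef size_quad_poly /= coefB coefD coefXn coefMX !coefC /=.
by rewrite addr0 subr0.
Qed.
End QuadPoly.

(** * Laurent polynomials over a field: integral closedness and squarefreeness *)

Section LaurentField.
Variable F : fieldType.
Implicit Types (f g : laurent F) (p q : {poly F}) (u : {fraction {poly F}}).

Lemma lfrac_lmono k (a : F) : lfrac (lmono k a) = tofrac a%:P * tofrac 'X ^ k.
Proof. exact: lhom_lmono. Qed.

Lemma lfrac_lC (a : F) : lfrac (lC a) = tofrac a%:P.
Proof. by rewrite lfrac_lmono expr0z mulr1. Qed.

Lemma lfrac_lpoly p : lfrac (lpoly p) = tofrac p.
Proof.
elim/poly_ind: p => [|p c IHp]; first by rewrite !rmorph0.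
rewrite !rmorphD !rmorphM /= IHp lpolyX lpolyC lfrac_lC; congr (_ * _ + _).
by rewrite lfrac_lmono tofrac1 mul1r expr1z.
Qed.

Lemma lfrac_inj : injective (@lfrac F).
Proof.
apply: raddf_inj => f /=; have [n [p ->]] := laurent_poly f.
rewrite rmorphM /= lfrac_lpoly lfrac_lmono tofrac1 mul1r => /eqP.
rewrite mulf_eq0 expfz_eq0 tofrac_eq0 polyX_eq0 andbF /= tofrac_eq0 => /eqP->.
by rewrite rmorph0 mulr0.
Qed.

Lemma laurent_eq0 f g : f * g = 0 -> f = 0 \/ g = 0.
Proof.
move=> fg0; have /eqP : lfrac f * lfrac g = 0 by rewrite -rmorphM /= fg0 rmorph0.
rewrite mulf_eq0 => /orP[] /eqP h; [left|right]; apply: lfrac_inj.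
  by rewrite h rmorph0.
by rewrite h rmorph0.
Qed.

Lemma fraction_div u : exists p q, q != 0 /\ u = tofrac p / tofrac q.
Proof.
elim/quotW: u => -[[p q] /= q0]; exists p, q; split => //.
have Fq : tofrac q != 0 by rewrite tofrac_eq0.
apply: (mulIf Fq); rewrite divfK //.
rewrite !piE; apply/eqP; rewrite eqmodE /=.
rewrite FracField.equivfE /FracField.mulf !numden_Ratio ?mulf_neq0 ?oner_eq0 //=.
by rewrite !mulr1 mulrC.
Qed.

Lemma fraction_coprime u : exists p q,
  [/\ coprimep p q, q != 0 & u = lfrac (lpoly p) / lfrac (lpoly q)].
Proof.
have [p [q [q0 ->]]] := fraction_div u.
have d0 : gcdp p q != 0 by rewrite gcdp_eq0 negb_and q0 orbT.
exists (p %/ gcdp p q), (q %/ gcdp p q); split.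
- by rewrite coprimep_div_gcd // q0 orbT.
- by rewrite divp_eq0 (negPf q0) (negPf d0) /= -leqNgt dvdp_leq // dvdp_gcdr.
- have -> : tofrac p = tofrac (p %/ gcdp p q) * tofrac (gcdp p q).
    by rewrite -tofracM divpK // dvdp_gcdl.
  have -> : tofrac q = tofrac (q %/ gcdp p q) * tofrac (gcdp p q).
    by rewrite -tofracM divpK // dvdp_gcdr.
  by rewrite !lfrac_lpoly -mulf_div divff ?mulr1 // tofrac_eq0.
Qed.

Lemma lpoly_bezout p q n : coprimep p q ->
  exists a b, a * lpoly p ^+ n + b * lpoly q ^+ n = 1.
Proof.
move=> pq; have : coprimep (p ^+ n) (q ^+ n) by rewrite coprimep_expl ?coprimep_expr.
move=> /Bezout_eq1_coprimepP [[a b] /= ab]; exists (lpoly a), (lpoly b).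
by rewrite -!rmorphXn -!rmorphM -rmorphD /= ab rmorph1.
Qed.

Lemma lfrac_of_inv p q c : lpoly q * c = 1 ->
  exists b, lfrac (lpoly p) / lfrac (lpoly q) = lfrac b.
Proof.
move=> qc; exists (lpoly p * c).
have q0 : lfrac (lpoly q) != 0.
  apply/eqP => q0; have := congr1 (@lfrac F) qc.
  by rewrite rmorphM /= q0 mul0r rmorph1 => /esym/eqP; rewrite oner_eq0.
by apply: (mulIf q0); rewrite divfK // -rmorphM /= -mulrA [c * _]mulrC qc mulr1.
Qed.

(** Rational root argument: for u = p/q in lowest terms the equation times q^n shows that q divides
    p^n, and Bezout for p^n and q makes q invertible as a Laurent polynomial. *)
Lemma integral_lfrac u : integralOver (@lfrac F) u -> exists b, u = lfrac b.
Proof.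
have [p [q [pq q0 ->]]] := fraction_coprime u; case=> P monP.
rewrite /root horner_coef (size_map_inj_poly lfrac_inj) ?rmorph0 //.
case szP: (size P) => [|n].
  by move: monP; rewrite monicE /lead_coef szP nth_default ?szP // eq_sym oner_eq0.
rewrite big_ord_recr /= => /eqP.
have Fq0 : lfrac (lpoly q) != 0 by rewrite lfrac_lpoly tofrac_eq0.
have -> : (map_poly (@lfrac F) P)`_n = 1.
  rewrite coef_map; move: monP; rewrite monicE /lead_coef szP => /eqP /= ->.
  by rewrite rmorph1.
rewrite mul1r.
move/(congr1 (fun v => lfrac (lpoly q) ^+ n * v)); rewrite mulr0 mulrDr mulr_sumr.
rewrite [X in _ + X]mulrC exprMn exprVn mulfVK ?expf_neq0 //.
(* Each lower term keeps a positive power of q; one factor q is split off, which leaves the exponent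
   [(n - i).-1]. *)
pose c := \sum_(i < n) P`_i * lpoly p ^+ i * lpoly q ^+ (n - i).-1.
have -> : \sum_(i < n) lfrac (lpoly q) ^+ n *
    ((map_poly (@lfrac F) P)`_i * (lfrac (lpoly p) / lfrac (lpoly q)) ^+ i) =
    lfrac (lpoly q * c).
  rewrite rmorphM rmorph_sum /= mulr_sumr; apply: eq_bigr => i _.
  rewrite !rmorphM !rmorphXn coef_map /= exprMn exprVn.
  have -> : lfrac (lpoly q) ^+ n =
      lfrac (lpoly q) * lfrac (lpoly q) ^+ (n - i).-1 * lfrac (lpoly q) ^+ i.
    by rewrite -exprS -exprD prednK ?subn_gt0 ?subnK // ltnW.
  have aux (G : fieldType) (q' w a c' p' : G) : a != 0 ->
      q' * w * a * (c' * (p' / a)) = q' * (c' * p' * w).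
    by move=> a0; field.
  exact/aux/expf_neq0.
rewrite -rmorphXn -rmorphD /= -(rmorph0 (@lfrac F)) => /lfrac_inj/eqP.
rewrite addr_eq0 => /eqP qcp.
have [a [b ab]] := lpoly_bezout 1 (coprimep_expl n pq).
apply: (lfrac_of_inv _ (c := b - a * c)).
rewrite -[RHS]ab !expr1 rmorphXn /=.
have -> : lpoly p ^+ n = - (lpoly q * c) by rewrite qcp opprK.
by rewrite mulrBr mulrN [b * _]mulrC [lpoly q * (a * c)]mulrCA addrC.
Qed.

(** With u = p/q in lowest terms, p^2 f = q^2 g; a relation a p^2 + b q^2 = 1 gives f = q^2 (a g + b
    f), and squarefreeness makes q a unit. *)
Lemma lfrac_squarefree f u (g : laurent F) :
  (forall p q : laurent F, f = p ^+ 2 * q -> exists p' : laurent F, p * p' = 1) ->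
  u ^+ 2 * lfrac f = lfrac g -> exists b, u = lfrac b.
Proof.
have [p [q [pq q0 ->]]] := fraction_coprime u => sqf.
have Fq0 : lfrac (lpoly q) != 0 by rewrite lfrac_lpoly tofrac_eq0.
rewrite expr_div_n => /(congr1 (fun v => v * lfrac (lpoly q) ^+ 2)).
rewrite mulrAC mulfVK ?expf_neq0 // -!rmorphXn -!rmorphM => /lfrac_inj pg.
have [a [b ab]] := lpoly_bezout 2 pq.
have [c qc] : exists c, lpoly q * c = 1.
  apply: (sqf _ (a * g + b * f)).
  rewrite !rmorphXn /= in pg.
  by rewrite -[LHS]mul1r -ab mulrDl -mulrA pg; ring.
exact: lfrac_of_inv qc.
Qed.

Lemma lfrac_sqrt u f : u ^+ 2 = lfrac f -> exists2 b, f = b ^+ 2 & u = lfrac b.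
Proof.
move=> uf; have [|b ub] := @integral_lfrac u.
  exists ('X^2 - f%:P); first by rewrite monicXnsubC.
  rewrite /root rmorphB rmorphXn /= map_polyX map_polyC !hornerE /=.
  by rewrite uf subrr.
by exists b => //; apply: lfrac_inj; rewrite rmorphXn /= -ub uf.
Qed.

Lemma lfrac_quad_root u f g :
  u ^+ 2 + lfrac f * u = lfrac g -> exists2 b, b ^+ 2 + f * b = g & u = lfrac b.
Proof.
move=> ufg; have [|b ub] := @integral_lfrac u.
  exists (quad_poly f g); first exact: quad_poly_monic.
  by rewrite /root map_quad_poly horner_quad_poly ufg subrr.
by exists b => //; apply: lfrac_inj; rewrite rmorphD rmorphM rmorphXn /= -ub.
Qed.

End LaurentField.

(** A nonzero coefficient at x^i survives derivation unless i vanishes in [k], that is, unless i is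
    even; it has a square root in [k], and in characteristic 2 sums of squares are squares. *)
Lemma lderiv_eq0_square (k : closedFieldType) (b : laurent k) :
  2 = 0 :> k -> lderiv b = 0 -> exists s, b = s ^+ 2.
Proof.
move=> k2 db0.
have lsq (c d : laurent k) : c ^+ 2 + d ^+ 2 = (c + d) ^+ 2.
  have l2 : 2 = 0 :> laurent k by rewrite -(rmorph_nat (@lC k)) k2 rmorph0.
  by rewrite sqrrD -mulr_natl l2 mul0r addr0.
rewrite [b]laurentE; apply: (@big_ind _ (fun c => exists s, c = s ^+ 2)).
- by exists 0; rewrite expr0n.
- by move=> _ _ [c ->] [d ->]; exists (c + d); rewrite lsq.
move=> i _.
have sqrtk (a : k) : exists r, r ^+ 2 = a.
  have [r] := @solve_monicpoly k 2 (fun n => if n is 0 then a else 0) isT.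
  by rewrite !big_ord_recr big_ord0 /= mul0r addr0 expr0 mulr1 add0r => ?; exists r.
have [/eqP b0|bn0] := eqVneq (lcoef i b) 0.
  by exists 0; rewrite expr0n (eqP b0) lmono0.
have i0 : i%:~R = 0 :> k.
  have /laurentP/(_ (i - 1)) := db0; rewrite lcoef_lderiv subrK lcoef0 -mulrzr.
  by move/eqP; rewrite mulf_eq0 (negPf bn0) /= => /eqP.
have odd_unit (n : nat) : n%:R = 0 :> k -> n = n./2.*2.
  move=> n0; rewrite -[LHS]odd_double_half; move: n0.
  rewrite -{1}[n]odd_double_half natrD -muln2 natrM k2 mulr0 addr0.
  by case: (odd n) => // /eqP; rewrite oner_eq0.
have [m ->] : exists m, i = m + m.
  case: i {bn0} i0 => n /=.
    by move=> /odd_unit ->; exists (n./2)%:Z; rewrite -PoszD addnn.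
  rewrite NegzE mulrNz => /eqP; rewrite oppr_eq0 => /eqP /odd_unit ->.
  by exists (- (n.+1./2)%:Z); rewrite -opprD -PoszD addnn.
have [r rr] := sqrtk (lcoef (m + m) b).
by exists (lmono m r); rewrite expr2 lmonoM -expr2 rr.
Qed.

(** * Free quadratic algebras *)

Section QuadAlg.
Variables (A : comNzRingType) (C : comPzRingType) (sigma : {rmorphism A -> C}).
Variables (tau : C) (al be : A).

(** Freeness on 1, [tau] is stated on elements, so that it can be checked alike for a polynomial
    quotient, for a ring modulo [mm] and for a subring of [L]. With b = 0 the last clause contains
    the injectivity of [sigma]. *)
Definition quad_alg : Prop :=
  [/\ tau ^+ 2 + sigma al * tau = sigma be,
      forall y, exists a b, y = sigma a + sigma b * tau &
      forall a b, sigma a + sigma b * tau = 0 -> a = 0 /\ b = 0].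

Hypothesis Q : quad_alg.

Lemma quad_alg_uniq a b a' b' :
  sigma a + sigma b * tau = sigma a' + sigma b' * tau -> a = a' /\ b = b'.
Proof.
case: Q => _ _ fr /eqP; rewrite -subr_eq0 opprD addrACA -mulrBl -!rmorphB.
by move=> /eqP /fr [/eqP + /eqP]; rewrite !subr_eq0 => /eqP-> /eqP->.
Qed.

Lemma quad_algM a b a' b' :
  (sigma a + sigma b * tau) * (sigma a' + sigma b' * tau) =
  sigma (a * a' + b * b' * be) + sigma (a * b' + b * a' - b * b' * al) * tau.
Proof.
case: Q => rel _ _; rewrite rmorphD rmorphB rmorphD !rmorphM /= -rel.
by move: (sigma a) (sigma b) (sigma a') (sigma b') (sigma al) => *; ring.
Qed.

(** The universal property of A[T]/(T^2 + al T - be), recovered from coordinates: being unique they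
    are additive, and [quad_algM] gives multiplicativity. *)
Lemma quad_alg_univ (T : comPzRingType) (psi : {rmorphism A -> T}) (t : T) :
  t ^+ 2 + psi al * t = psi be ->
  exists phi : {rmorphism C -> T}, (forall a, phi (sigma a) = psi a) /\ phi tau = t.
Proof.
move=> ht; case: (Q) => rel sp _.
have /choice[c cP] : forall y, exists p : A * A, y = sigma p.1 + sigma p.2 * tau.
  by move=> y; have [a [b ->]] := sp y; exists (a, b).
pose phi y := psi (c y).1 + psi (c y).2 * t.
have phiE a b : phi (sigma a + sigma b * tau) = psi a + psi b * t.
  by rewrite /phi; have [<- <-] := quad_alg_uniq (cP (sigma a + sigma b * tau)).
have phiA a : phi (sigma a) = psi a.
  by rewrite -[sigma a]addr0 -(mul0r tau) -(rmorph0 sigma) phiE rmorph0 mul0r addr0.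
have phiB : zmod_morphism phi.
  move=> x y; have [a [b ->]] := sp x; have [a' [b' ->]] := sp y.
  rewrite opprD addrACA -mulrBl -!rmorphB !phiE !rmorphB.
  by rewrite mulrBl opprD addrACA.
have phiM : monoid_morphism phi.
  split=> [|x y]; first by rewrite -(rmorph1 sigma) phiA rmorph1.
  have [a [b ->]] := sp x; have [a' [b' ->]] := sp y.
  rewrite quad_algM !phiE rmorphD rmorphB rmorphD !rmorphM /= -ht.
  by move: (psi a) (psi b) (psi a') (psi b') (psi al) => *; ring.
pose fadd := GRing.isZmodMorphism.Build C T phi phiB.
pose fmul := GRing.isMonoidMorphism.Build C T phi phiM.
pose phi' : {rmorphism C -> T} := HB.pack phi fadd fmul.
exists phi'; split=> /= [a|]; first exact: phiA.
by rewrite -[tau]mul1r -[1 * _]add0r -(rmorph0 sigma) -(rmorph1 sigma) phiE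
  rmorph0 rmorph1 mul1r add0r.
Qed.

End QuadAlg.

Lemma rmorph_descend (A A' T : pzRingType) (rho : {rmorphism A -> A'})
    (psi : {rmorphism A -> T}) :
  (forall c, exists r, rho r = c) -> (forall r, rho r = 0 -> psi r = 0) ->
  exists psi' : {rmorphism A' -> T}, forall r, psi' (rho r) = psi r.
Proof.
move=> /choice[lift liftK] ker; pose f c := psi (lift c).
have fE r : f (rho r) = psi r.
  by apply/eqP; rewrite -subr_eq0 -rmorphB ker // rmorphB liftK subrr.
have fB : zmod_morphism f.
  by move=> x y; rewrite -[x]liftK -[y]liftK -rmorphB !fE rmorphB.
have fM : monoid_morphism f.
  split=> [|x y]; first by rewrite -(rmorph1 rho) fE rmorph1.
  by rewrite -[x]liftK -[y]liftK -rmorphM !fE rmorphM.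
pose fadd := GRing.isZmodMorphism.Build A' T f fB.
pose fmul := GRing.isMonoidMorphism.Build A' T f fM.
pose psi' : {rmorphism A' -> T} := HB.pack f fadd fmul.
by exists psi'.
Qed.

Section QPoly.
Variables (A : comNzRingType) (a b : A).
Local Notation p := (quad_poly a b).

(** [{poly %/ p}] divides by [mk_monic p], which falls back to ['X] unless [p] is monic of positive
    degree. *)
Lemma mk_monic_quad : mk_monic p = p.
Proof. by rewrite /mk_monic size_quad_poly quad_poly_monic. Qed.

Lemma in_qpoly_quadC c : in_qpoly p c%:P = qpolyC p c.
Proof.
apply: val_inj; apply: in_qpoly_small.
by rewrite mk_monic_quad size_quad_poly (leq_ltn_trans (size_polyC_leq1 _)).
Qed.

Lemma quad_alg_qpoly : quad_alg (qpolyC p) 'qX a b.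
Proof.
have sz2 (c d : A) : (size (c%:P + d%:P * 'X)%R < size (mk_monic p))%N.
  rewrite mk_monic_quad size_quad_poly ltnS (leq_trans (size_polyD _ _)) //.
  rewrite geq_max (leq_trans (size_polyC_leq1 _)) //.
  by rewrite (leq_trans (size_polyMleq _ _)) // size_polyX addn2 /= ltnS size_polyC_leq1.
have linE c d : qpolyC p c + qpolyC p d * 'qX = in_qpoly p (c%:P + d%:P * 'X).
  by rewrite in_qpolyD in_qpolyM !in_qpoly_quadC.
split=> [|y|c d].
- apply/eqP; rewrite -subr_eq0; apply/eqP.
  have -> : 'qX ^+ 2 + qpolyC p a * 'qX - qpolyC p b = in_qpoly p p.
    by rewrite [X in _ = in_qpoly _ X]/quad_poly rmorphB rmorphD rmorphXn rmorphM /= !in_qpoly_quadC.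
  apply: val_inj => /=; rewrite mk_monic_quad.
  exact/Pdiv.RingMonic.rmodpp/quad_poly_monic.
- exists (y : {poly A})`_0, (y : {poly A})`_1.
  rewrite linE; apply: val_inj; apply: (etrans _ (esym (in_qpoly_small (sz2 _ _)))).
  apply/polyP => i.
  rewrite coefD coefC coefMX coefC.
  case: i => [|[|i]] /=; rewrite ?addr0 ?add0r //.
  by rewrite nth_default // -ltnS (leq_trans (size_mk_monic y)) // mk_monic_quad size_quad_poly.
- move=> cd0; have /polyP cd : c%:P + d%:P * 'X = 0 :> {poly A}.
    by rewrite -(in_qpoly_small (sz2 c d)) -linE cd0.
  have := cd 0%N; have := cd 1%N.
  by rewrite !coefD !coefMX !coefC /= ?coef0 ?addr0 ?add0r => -> ->.
Qed.
End QPoly.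

Section QuotientTheory.
Variables (S : comPzRingType) (E : set S).

Lemma mem_ideal_gen x : E x -> x \in ideal_gen E.
Proof.
move=> Ex; apply/asboolP; exists [:: (1, x)]; split.
  by move=> p; rewrite inE => /eqP ->.
by rewrite big_seq1 mul1r.
Qed.

Lemma quot_pi_eq0 x : quot_pi E x = 0 <-> x \in ideal_gen E.
Proof. by rewrite -(rmorph0 (quot_pi E)) quot_piE subr0. Qed.
End QuotientTheory.

(** * The special fibre as a quadratic algebra *)

Section Fiber.
Variables (R k : comNzRingType) (res : {rmorphism R -> k}) (mm : set R).
Variables (a b : laurent R).
Hypothesis res_surj : forall c : k, exists r, res r = c.
Hypothesis res_ker : forall r, res r = 0 <-> mm r.

Local Notation E := [set model_in a b (lC r) | r in mm]%classic.

(** Elements of the ideal generated by the constants in [mm] have both coordinates reducing to 0, so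
    the basis 1, T survives in the quotient, now over [laurent k]. *)
Lemma fiber_quad_alg : exists sigma : {rmorphism laurent k -> model_fiber mm a b},
  (forall c, sigma (lmap res c) = fiber_in mm a b c) /\
  quad_alg sigma (quot_pi E (model_T a b)) (lmap res a) (lmap res b).
Proof.
pose fib : {rmorphism laurent R -> model_fiber mm a b} := quot_pi E \o qpolyC (quad_poly a b).
have [||sigma sigmaE] := @rmorph_descend _ _ _ (lmap res) fib.
- exact: lmap_surj.
- move=> c c0; apply/quot_pi_eq0; rewrite [c]laurentE rmorph_sum.
  apply: rpred_sum => i _; rewrite lmono_lC mulrC rmorphM; apply: ideal_genMl.
  apply: mem_ideal_gen; exists (lcoef i c) => //.
  by apply/res_ker; rewrite -lcoef_lmap c0 lcoef0.
exists sigma; split=> //; have [rel sp fr] := quad_alg_qpoly a b.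
split=> [|y|c d].
- rewrite !sigmaE /fib /= -rmorphXn -rmorphM -rmorphD /=; congr (quot_pi _ _).
  exact: rel.
- have [c [d yE]] := sp (repr (y : {ideal_quot ideal_gen E})%qT).
  exists (lmap res c), (lmap res d); rewrite !sigmaE /fib /= -rmorphM -rmorphD.
  exact: etrans (esym (quot_pi_repr y)) (congr1 (quot_pi E) yE).
- have [c' <-] := lmap_surj res_surj c; have [d' <-] := lmap_surj res_surj d.
  rewrite !sigmaE /fib /= -rmorphM -rmorphD => /quot_pi_eq0 /asboolP[r [rE]].
  (* Induction on the list of generators: a term y s contributes the coordinates of y multiplied by
     s, and these reduce to 0. *)
  suff [p [q [-> p0 q0]]] : exists p q,
      [/\ \sum_(p0 <- r) p0.1 * p0.2 = qpolyC (quad_poly a b) p + qpolyC (quad_poly a b) q * 'qX,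
        lmap res p = 0 & lmap res q = 0].
    by move=> /(quad_alg_uniq (quad_alg_qpoly a b)) [-> ->].
  elim: r rE => [_|[y x] r IHr rE].
    by exists 0, 0; rewrite big_nil !rmorph0 mul0r addr0.
  have [|p [q [sE p0 q0]]] := IHr; first by move=> t tr; apply: rE; rewrite inE tr orbT.
  have [s sm /= sx] := rE (y, x) (mem_head _ _).
  have [p' [q' yE]] := sp y.
  have ress : lmap res (lC s) = 0 by rewrite lmap_lmono (proj2 (res_ker s) sm) lmono0.
  exists (p + p' * lC s), (q + q' * lC s); rewrite big_cons sE -sx yE; split.
  + rewrite !rmorphD !rmorphM /= /model_in.
    by move: (qpolyC _ _) (qpolyC _ _) (qpolyC _ _) (qpolyC _ _) (qpolyC _ _) => *; ring.
  + by rewrite rmorphD rmorphM /= ress mulr0 addr0.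
  + by rewrite rmorphD rmorphM /= ress mulr0 addr0.
Qed.

End Fiber.

(** * Spectra and smoothness *)

Lemma laurent_ext (S : comNzRingType) (T : comPzRingType)
    (phi psi : {rmorphism laurent S -> T}) :
  (forall c, phi (lC c) = psi (lC c)) -> phi (lmono 1 1) = psi (lmono 1 1) ->
  phi =1 psi.
Proof.
move=> eqC eqX f; have [n [p ->]] := laurent_poly f.
have eqP q : phi (lpoly q) = psi (lpoly q).
  elim/poly_ind: q => [|q c IHq]; first by rewrite !rmorph0.
  by rewrite !rmorphD !rmorphM /= IHq lpolyC lpolyX eqC eqX.
rewrite !rmorphM /= eqP; congr (_ * _).
have eqM : phi (lmono n 1) = psi (lmono n 1) by rewrite -!lpolyXn eqP.
rewrite -[LHS]mulr1 -(rmorph1 psi) -(lmonoK S n) rmorphM /= -eqM mulrA -rmorphM /=.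
by rewrite [_ * lmono n 1]mulrC lmonoK rmorph1 mul1r.
Qed.

Section SpecTheory.
Variable C : comPzRingType.
Implicit Types P Q : spec C.

Lemma spec_eq P Q : (forall x, spec_val P x <-> spec_val Q x) -> P = Q.
Proof.
case: P Q => [P Pp] [Q Qp] /= PQ.
have ePQ : P = Q by apply/funext => x; apply/propext.
by subst Q; congr Spec; apply: Prop_irrelevance.
Qed.

Lemma spec0 P : spec_val P 0. Proof. by case: P => P []. Qed.
Lemma spec1 P : ~ spec_val P 1. Proof. by case: P => P []. Qed.
Lemma specD P a b : spec_val P a -> spec_val P b -> spec_val P (a + b).
Proof. by case: P => P [? PD ? ? ?]; apply: PD. Qed.
Lemma specMl P a b : spec_val P b -> spec_val P (a * b).
Proof. by case: P => P [? ? PM ? ?]; apply: PM. Qed.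
Lemma spec_prime P a b : spec_val P (a * b) -> spec_val P a \/ spec_val P b.
Proof. by case: P => P [? ? ? ? PM]; apply: PM. Qed.
Lemma specB P a b : spec_val P a -> spec_val P b -> spec_val P (a - b).
Proof. by move=> Pa Pb; apply: specD => //; rewrite -mulN1r; apply: specMl. Qed.
Lemma specDl P a b : spec_val P b -> spec_val P (a + b) -> spec_val P a.
Proof. by move=> Pb Pab; rewrite -(addrK b a); apply: specB. Qed.
Lemma spec_unit P a b : a * b = 1 -> ~ spec_val P a.
Proof. by move=> ab Pa; apply: (@spec1 P); rewrite -ab mulrC; apply: specMl. Qed.

End SpecTheory.

Lemma finite_subsingleton (T : Type) (A : set T) :
  (forall x y, A x -> A y -> x = y) -> finite_set A.
Proof.
move=> sub; have [[x Ax]|nA] := pselect (exists x, A x).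
  by apply: (@sub_finite_set _ _ [set x]%classic) => // y /sub; apply.
apply: (@sub_finite_set _ _ set0%classic) => // y Ay.
by case: nA; exists y.
Qed.

Section LaurentResidue.
Variables (F : fieldType) (z : F).
Hypothesis z0 : z != 0.
Local Notation x := (lmono 1 1 : laurent F).

Lemma laurent_mod_point (a : laurent F) :
  exists e c, a = lC e + (x - lC z) * c.
Proof.
pose D (a : laurent F) := exists e c, a = lC e + (x - lC z) * c.
have DC e : D (lC e) by exists e, 0; rewrite mulr0 addr0.
have DD a1 a2 : D a1 -> D a2 -> D (a1 + a2).
  move=> [e1 [c1 ->]] [e2 [c2 ->]]; exists (e1 + e2), (c1 + c2).
  by rewrite rmorphD mulrDr addrACA.
have DM a1 a2 : D a1 -> D a2 -> D (a1 * a2).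
  move=> [e1 [c1 ->]] [e2 [c2 ->]].
  exists (e1 * e2), (c1 * lC e2 + lC e1 * c2 + (x - lC z) * c1 * c2).
  by rewrite rmorphM /=; move: (lC e1) (lC e2) (x - _) => *; ring.
have DX : D x by exists z, 1; rewrite mulr1 addrC subrK.
have DXN n : D (lmono (- n%:Z) 1).
  have D1 : D (lmono (- 1) 1).
    (* This is x^-1 = z^-1 - x^-1 z^-1 (x - z). *)
    exists z^-1, (- (lmono (- 1) 1 * lC z^-1)).
    have zz : lC z * lC z^-1 = 1 by rewrite -rmorphM /= divff // rmorph1.
    have xx := lmonoK F 1.
    have -> : lC z^-1 + (x - lC z) * - (lmono (-1) 1 * lC z^-1) =
       lC z^-1 - (x * lmono (-1) 1) * lC z^-1 + lmono (-1) 1 * (lC z * lC z^-1).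
      by move: (lmono _ _) (lmono _ _) (lC _) (lC _) => *; ring.
    by rewrite xx zz mul1r subrr add0r mulr1.
  elim: n => [|n IHn]; first exact: DC.
  have -> : lmono (- n.+1%:Z) 1 = lmono (-1) 1 * lmono (- n%:Z) 1 :> laurent F.
    by rewrite lmonoM mulr1 intS opprD.
  exact: DM.
have [n [p ->]] := laurent_poly a; apply: (DM) => //.
elim/poly_ind: p => [|p c IHp]; first by rewrite rmorph0; exists 0, 0; rewrite rmorph0 mulr0 addr0.
by rewrite rmorphD rmorphM /= lpolyC lpolyX; apply: DD => //; apply: DM.
Qed.
End LaurentResidue.

Section Zeros.
Variables (k : closedFieldType) (C : comPzRingType).
Variables (sigma : {rmorphism laurent k -> C}) (tau : C) (al be : laurent k).
Hypothesis Q : quad_alg sigma tau al be.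
Local Notation x := (lmono 1 1 : laurent k).
Implicit Types P : spec C.

Lemma spec_lC P c : spec_val P (sigma (lC c)) -> c = 0.
Proof.
move=> Pc; apply/eqP/negPn/negP => c0; move: Pc.
by apply: (@spec_unit _ _ _ (sigma (lC c^-1))); rewrite -!rmorphM divff // !rmorph1.
Qed.

Lemma spec_point_neq0 P z : spec_val P (sigma (x - lC z)) -> z != 0.
Proof.
move=> Pxz; apply/eqP => z0; move: Pxz; rewrite z0 rmorph0 subr0.
apply: (@spec_unit _ _ _ (sigma (lmono (- 1) 1))).
by rewrite -rmorphM /= lmonoK rmorph1.
Qed.

(** Modulo x - z and tau - r every element is a constant, and a prime contains no constant but 0; so
    both primes have the same elements. *)
Lemma spec_point_uniq z r P P' :
  spec_val P (sigma (x - lC z)) -> spec_val P (tau - sigma (lC r)) ->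
  spec_val P' (sigma (x - lC z)) -> spec_val P' (tau - sigma (lC r)) -> P = P'.
Proof.
move=> Pz Pr P'z P'r; have z0 := spec_point_neq0 Pz.
case: Q => _ sp _; apply: spec_eq => y.
have [e [c [d ->]]] : exists e c d,
    y = sigma (lC e) + (c * sigma (x - lC z) + d * (tau - sigma (lC r))).
  have [a [b ->]] := sp y; have [e [c ec]] := laurent_mod_point z0 (a + b * lC r).
  exists e, (sigma c), (sigma b); rewrite addrA [sigma c * _]mulrC -rmorphM -rmorphD /= -ec.
  by rewrite rmorphD rmorphM mulrBr addrACA subrr addr0.
have inP (P0 : spec C) : spec_val P0 (sigma (x - lC z)) ->
    spec_val P0 (tau - sigma (lC r)) ->
    (spec_val P0 (sigma (lC e) + (c * sigma (x - lC z) + d * (tau - sigma (lC r)))) <-> e = 0).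
  move=> P0z P0r.
  have rest : spec_val P0 (c * sigma (x - lC z) + d * (tau - sigma (lC r))).
    by apply: specD; apply: specMl.
  split=> [/(specDl rest)/spec_lC //|->].
  by rewrite !rmorph0 add0r.
by rewrite !inP.
Qed.

(** At x = z the quadratic has roots r1 and r2 in [k] with sum [- e1]; the product of tau - r1 and
    tau - r2 is a multiple of x - z, so a prime above z contains one of them. *)
Lemma spec_point_tau z : exists r1 r2, forall P, spec_val P (sigma (x - lC z)) ->
  spec_val P (tau - sigma (lC r1)) \/ spec_val P (tau - sigma (lC r2)).
Proof.
have [z0|z0] := eqVneq z 0.
  (* No prime contains the unit x, so for z = 0 any values serve. *)
  by exists 0, 0 => P /spec_point_neq0; rewrite z0 eqxx.
have [e1 [c1 ale]] := laurent_mod_point z0 al.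
have [e2 [c2 bee]] := laurent_mod_point z0 be.
have [r1 r1E] := @solve_monicpoly k 2 (fun n => if n is 0 then e2 else - e1) isT.
rewrite !big_ord_recr big_ord0 /= add0r expr0 expr1 mulr1 in r1E.
exists r1, (- e1 - r1) => P Pz; apply: spec_prime.
case: Q => rel _ _.
have -> : (tau - sigma (lC r1)) * (tau - sigma (lC (- e1 - r1))) =
    (sigma c2 - sigma c1 * tau) * sigma (x - lC z).
  rewrite -[LHS]subr0 -(subrr (sigma be)) -{1}rel ale bee.
  rewrite !(rmorphB, rmorphN) !rmorphD !rmorphM /= ?rmorphB /=.
  have re : sigma (lC e2) = sigma (lC r1) ^+ 2 + sigma (lC e1) * sigma (lC r1).
    by rewrite -!rmorphXn -!rmorphM -!rmorphD /= r1E mulNr subrK.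
  rewrite re; move: (sigma _) (sigma _) (sigma _) (sigma _) (sigma _) (sigma _) => *; ring.
exact: specMl.
Qed.

(** A prime containing [d] contains a linear factor x - z of its numerator, and above each z lie at
    most two primes. *)
Lemma zeros_finite d : d != 0 -> finite_set [set P : spec C | spec_val P (sigma d)]%classic.
Proof.
have [n [p dE]] := laurent_poly d => d0.
have p0 : p != 0 by apply: contra_neq d0 => p0; rewrite dE p0 rmorph0 mulr0.
have [rs pE] := closed_field_poly_normal p.
have step (s : seq k) : finite_set
    [set P : spec C | spec_val P (sigma (lpoly (\prod_(z <- s) ('X - z%:P))))]%classic.
  elim: s => [|z s IHs].
    apply: (@sub_finite_set _ _ set0%classic) => // P /=.
    by rewrite big_nil !rmorph1 => /spec1.
  have [r1 [r2 r12]] := spec_point_tau z.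
  pose pt r := [set P : spec C | spec_val P (sigma (x - lC z)) /\ spec_val P (tau - sigma (lC r))]%classic.
  have ptF r : finite_set (pt r).
    by apply: finite_subsingleton => P P' [? ?] [? ?]; apply: (@spec_point_uniq z r).
  apply: (@sub_finite_set _ _ (pt r1 `|` pt r2 `|` [set P : spec C | spec_val P (sigma (lpoly (\prod_(z <- s) ('X - z%:P))))])%classic).
    move=> P /=; rewrite big_cons !rmorphM rmorphB /= lpolyX lpolyC => /spec_prime[Pz|]; last by right.
    by left; case: (r12 P Pz) => Pr; [left|right].
  by rewrite !finite_setU.
apply: sub_finite_set (step rs) => P /= Pd.
have : spec_val P (sigma (lpoly p)).
  have -> : lpoly p = lmono n%:Z 1 * d by rewrite dE mulrA lmonoK mul1r.
  by rewrite rmorphM; apply: specMl.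
rewrite {1}pE -mul_polyC !rmorphM /= lpolyC => /spec_prime[/spec_lC/eqP|//].
by rewrite lead_coef_eq0 (negPf p0).
Qed.

Lemma quad_alg_finite_type : finite_type (sigma \o @lC k).
Proof.
exists [:: sigma x; sigma (lmono (- 1) 1); tau] => D DC Ds DD DM.
have Dx : D (sigma x) by apply: Ds; rewrite inE eqxx.
have Dy : D (sigma (lmono (- 1) 1)) by apply: Ds; rewrite !inE eqxx orbT.
have Dt : D tau by apply: Ds; rewrite !inE eqxx !orbT.
have Dsig a : D (sigma a).
  have [n [p ->]] := laurent_poly a; rewrite rmorphM; apply: (DM).
    elim: n => [|n IHn]; first exact: DC.
    have -> : lmono (- n.+1%:Z) 1 = lmono (-1) 1 * lmono (- n%:Z) 1 :> laurent k.
      by rewrite lmonoM mulr1 intS opprD.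
    by rewrite rmorphM; apply: DM.
  elim/poly_ind: p => [|p c IHp]; first by rewrite !rmorph0 -(rmorph0 sigma) -(rmorph0 (@lC k)); apply: DC.
  by rewrite !rmorphD !rmorphM /= lpolyC lpolyX; apply: DD; [apply: DM|apply: DC].
by case: Q => _ sp _ y; have [a [b ->]] := sp y; apply: DD => //; apply: DM.
Qed.

Lemma smooth_outside_of_formally_smooth d : d != 0 ->
  formally_smooth_on (sigma \o @lC k) (sigma d) ->
  smooth_outside_finite_zeros (sigma \o @lC k) (sigma d).
Proof.
move=> d0 fs; split; first exact: zeros_finite.
by move=> P Pd; split; [exact: quad_alg_finite_type|exists (sigma d)].
Qed.

End Zeros.

(** * Lifting along square-zero extensions *)

Section SquareZero.
Variables (T T' : comPzRingType) (q : {rmorphism T -> T'}).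
Hypothesis q_surj : forall y, exists x, q x = y.
Hypothesis q_sq0 : forall a b, q a = 0 -> q b = 0 -> a * b = 0.

Lemma unit_lift a e : q a * e = 1 -> exists i, a * i = 1.
Proof.
have [e' <-] := q_surj e; rewrite -rmorphM => qae.
have n0 : q (a * e' - 1) = 0 by rewrite rmorphB qae rmorph1 subrr.
(* With a e' = 1 + n and n^2 = 0, the inverse of 1 + n is 1 - n. *)
exists (e' * (1 - (a * e' - 1))).
have := q_sq0 n0 n0; move: e' {qae n0} => e' h.
have -> : a * (e' * (1 - (a * e' - 1))) = 1 - (a * e' - 1) * (a * e' - 1) by ring.
by rewrite h subr0.
Qed.

Variables (k : fieldType) (s : {rmorphism k -> T}) (u : {rmorphism laurent k -> T'}).
Hypothesis us : forall c, u (lC c) = q (s c).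

(** Any preimage of the image of x is again a unit, so [laurent k] is formally smooth over [k]. *)
Lemma laurent_lift : exists psi : {rmorphism laurent k -> T},
  (forall c, psi (lC c) = s c) /\ forall a, q (psi a) = u a.
Proof.
have [xi xiE] := q_surj (u (lmono 1 1)).
have [|eta xieta] := @unit_lift xi (u (lmono (- 1) 1)).
  by rewrite xiE -rmorphM /= lmonoK rmorph1.
have [psi [psiC psiX]] := laurent_univ s xieta.
exists psi; split=> // a.
rewrite -[q (psi a)]/((q \o psi : {rmorphism laurent k -> T'}) a).
by apply: laurent_ext => [c|] /=; rewrite ?psiC ?us // psiX xiE.
Qed.
End SquareZero.

Section Smoothness.
Variables (k : fieldType) (C : comPzRingType).
Variables (sigma : {rmorphism laurent k -> C}) (tau : C) (al be : laurent k).
Hypothesis Q : quad_alg sigma tau al be.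

(** Lifting [u] comes down to a lift [psi] on Laurent polynomials together with a root [t], above
    [u tau], of the transported quadratic. *)
Lemma quad_alg_lift (T T' : comPzRingType) (q : {rmorphism T -> T'})
    (s : {rmorphism k -> T}) (u : {rmorphism C -> T'})
    (psi : {rmorphism laurent k -> T}) (t : T) :
  (forall c, psi (lC c) = s c) -> (forall a, q (psi a) = u (sigma a)) ->
  q t = u tau -> t ^+ 2 + psi al * t = psi be ->
  exists u' : {rmorphism C -> T},
      (forall c, u' ((sigma \o @lC k) c) = s c) /\ (forall x, q (u' x) = u x).
Proof.
move=> psis qpsi qt ht; have [u' [u'A u't]] := quad_alg_univ Q ht.
exists u'; split=> [c|y] /=; first by rewrite u'A psis.
case: Q => _ sp _; have [a [b ->]] := sp y.
by rewrite !rmorphD !rmorphM /= !u'A u't !qpsi qt.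
Qed.

(** One Newton step: an arbitrary lift [t0] of tau has an error [ep] killed by [q], the derivative
    of the quadratic is [psi al] because 2 = 0, and the square of the correction vanishes. The locus
    is given by al^2 because in (b) and (c) it is [f] = [h]^2. *)
Lemma formally_smooth_lin d : 2 = 0 :> k -> d = al ^+ 2 ->
  formally_smooth_on (sigma \o @lC k) (sigma d).
Proof.
move=> k2 -> T T' q s u qs q0 us [e ude].
have [psi [psiC psiq]] := @laurent_lift _ _ q qs q0 k s (u \o sigma) us.
have [t0 t0E] := qs (u tau).
have [|i ali] := @unit_lift _ _ q qs q0 (psi al) (u (sigma al) * e).
  by rewrite psiq /= mulrA -expr2 -!rmorphXn.
pose ep := t0 ^+ 2 + psi al * t0 - psi be.
case: (Q) => rel _ _.
have qep : q ep = 0.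
  by rewrite /ep rmorphB rmorphD rmorphXn rmorphM /= !psiq t0E /= -rmorphXn -rmorphM -rmorphD /= rel subrr.
have qdel : q (- (ep * i)) = 0 by rewrite rmorphN rmorphM /= qep mul0r oppr0.
apply: (@quad_alg_lift _ _ q s u psi (t0 - ep * i)) => //.
  by rewrite rmorphD /= qdel addr0.
have T2 : 2 = 0 :> T by rewrite -(rmorph_nat s) k2 rmorph0.
have dd := q0 _ _ qdel qdel.
have -> : (t0 - ep * i) ^+ 2 + psi al * (t0 - ep * i) =
    t0 ^+ 2 + psi al * t0 - ep * (psi al * i) - 2 * (t0 * (ep * i)) + - (ep * i) * - (ep * i).
  by ring.
by rewrite dd T2 mul0r ali mulr1 subr0 addr0 /ep opprB addrC subrK.
Qed.

(** Here the lift [t0] of tau is kept and the lift of the Laurent polynomials is moved along the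
    derivation: as [del] has square zero, [chi] is again a ring morphism, and it shifts [psi be] by
    psi(be') del = [ep]. *)
Lemma formally_smooth_insep : al = 0 ->
  formally_smooth_on (sigma \o @lC k) (sigma (lderiv be)).
Proof.
move=> al0 T T' q s u qs q0 us [e ude].
have [psi [psiC psiq]] := @laurent_lift _ _ q qs q0 k s (u \o sigma) us.
have [t0 t0E] := qs (u tau).
have [|i bei] := @unit_lift _ _ q qs q0 (psi (lderiv be)) e.
  by rewrite psiq.
pose ep := t0 ^+ 2 - psi be.
case: (Q) => rel _ _; rewrite al0 rmorph0 mul0r addr0 in rel.
have qep : q ep = 0.
  by rewrite /ep rmorphB rmorphXn /= !psiq t0E /= -rmorphXn /= rel subrr.
pose del := ep * i.
have qdel : q del = 0 by rewrite rmorphM /= qep mul0r.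
have dd := q0 _ _ qdel qdel.
pose chi a := psi a + psi (lderiv a) * del.
have chiB : zmod_morphism chi.
  move=> a b; rewrite /chi !(raddfB (@lderiv k)) !rmorphB /=.
  by rewrite mulrBl opprD addrACA.
have chiM : monoid_morphism chi.
  split=> [|a b]; rewrite /chi.
    by rewrite -[1]/(lC 1) lderivC rmorph0 mul0r addr0 rmorph1.
  rewrite lderivM rmorphD !rmorphM /=.
  have -> : (psi a + psi (lderiv a) * del) * (psi b + psi (lderiv b) * del) =
     psi a * psi b + (psi (lderiv a) * psi b + psi a * psi (lderiv b)) * del +
     psi (lderiv a) * psi (lderiv b) * (del * del) by ring.
  by rewrite dd mulr0 addr0.
pose fadd := GRing.isZmodMorphism.Build (laurent k) T chi chiB.
pose fmul := GRing.isMonoidMorphism.Build (laurent k) T chi chiM.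
pose psi' : {rmorphism laurent k -> T} := HB.pack chi fadd fmul.
apply: (@quad_alg_lift _ _ q s u psi' t0) => //= [c|a|]; rewrite /chi.
- by rewrite lderivC rmorph0 mul0r addr0 psiC.
- by rewrite rmorphD rmorphM /= qdel mulr0 addr0 psiq.
- rewrite al0 (raddf0 (@lderiv k)) !rmorph0 !mul0r !addr0 mul0r addr0.
  by rewrite /del mulrCA bei mulr1 /ep addrC subrK.
Qed.

End Smoothness.

(** * Function fields of quadratic algebras *)

Lemma lfracM (F : fieldType) (a b : laurent F) : lfrac (a * b) = lfrac a * lfrac b.
Proof. exact: rmorphM. Qed.

(** a/b is a square root of g in the fraction field, hence a Laurent polynomial by integral
    closedness. *)
Lemma laurent_quotient_sqrt (F : fieldType) (a b g : laurent F) :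
  b != 0 -> a ^+ 2 = b ^+ 2 * g -> exists s, g = s ^+ 2.
Proof.
move=> b0 ab.
have aux (G : fieldType) (x y w : G) : y != 0 -> x ^+ 2 = y ^+ 2 * w -> (x / y) ^+ 2 = w.
  by move=> y0 xy; rewrite expr_div_n xy mulrAC divff ?mul1r // expf_neq0.
have [|s sE _] := @lfrac_sqrt _ (lfrac a / lfrac b) g; last by exists s.
apply: aux; first by rewrite -(rmorph0 (@lfrac F)) (inj_eq (@lfrac_inj F)).
by rewrite -!rmorphXn -lfracM -ab.
Qed.

Section InAlg.
Variables (F : fieldType) (M : fieldExtType F).
Implicit Types a b : F.

Lemma in_alg0 : 0%:A = 0 :> M. Proof. exact: scale0r. Qed.
Lemma in_algD a b : (a + b)%:A = a%:A + b%:A :> M. Proof. exact: scalerDl. Qed.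
Lemma in_algN a : (- a)%:A = - a%:A :> M. Proof. exact: scaleNr. Qed.
Lemma in_algM a b : (a * b)%:A = a%:A * b%:A :> M.
Proof. exact: (rmorphM (in_alg M)). Qed.
Lemma in_algXn a n : (a ^+ n)%:A = a%:A ^+ n :> M.
Proof. exact: (rmorphXn (in_alg M)). Qed.
Lemma in_alg_eq0 a : (a%:A == 0 :> M) = (a == 0).
Proof. exact: (fmorph_eq0 (in_alg M)). Qed.
Lemma in_alg_inj : injective (fun a => a%:A : M).
Proof. exact: (fmorph_inj (in_alg M)). Qed.
End InAlg.

Section QuadraticExtension.
Variables (F : fieldType) (M : fieldExtType F) (z : M) (a b : F).
Hypothesis zE : z ^+ 2 + a%:A * z = b%:A.

Lemma quad_ext_span : <<1; z>>%VS = fullv ->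
  forall y : M, exists p q : F, y = p%:A + q%:A * z.
Proof.
move=> gen y; pose D (y : M) := exists p q : F, y = p%:A + q%:A * z.
have DD y1 y2 : D y1 -> D y2 -> D (y1 + y2).
  move=> [p1 [q1 ->]] [p2 [q2 ->]]; exists (p1 + p2), (q1 + q2).
  by rewrite !in_algD mulrDl addrACA.
have DZ y1 c : D y1 -> D (c%:A * y1).
  move=> [p1 [q1 ->]]; exists (c * p1), (c * q1).
  by rewrite !in_algM mulrDr !mulrA.
have Dz y1 : D y1 -> D (y1 * z).
  move=> [p1 [q1 ->]]; exists (q1 * b), (p1 - q1 * a).
  rewrite in_algD in_algN !in_algM -zE.
  by move: (p1%:A) (q1%:A) (a%:A) => *; ring.
have DC c : D c%:A by exists c, 0; rewrite in_alg0 mul0r addr0.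
have : y \in <<1; z>>%VS by rewrite gen memvf.
case/Fadjoin_polyP => p /polyOverP p1 ->; rewrite horner_coef.
apply: (@big_ind _ D) => //; first by exists 0, 0; rewrite scale0r mul0r addr0.
move=> i _; have /vlineP[c ->] := p1 i; apply: DZ.
elim: (i : nat) => [|n IHn]; first by rewrite expr0 -[1]scale1r.
by rewrite exprSr; apply: Dz.
Qed.

Lemma quad_ext_free p q : (forall u : F, u ^+ 2 + a * u != b) ->
  p%:A + q%:A * z = 0 -> p = 0 /\ q = 0.
Proof.
move=> noroot pq0; have [q0|q0] := eqVneq q 0.
  by split=> //; apply: (@in_alg_inj _ M); rewrite in_alg0 -pq0 q0 in_alg0 mul0r addr0.
have zu : z = (- p / q)%:A.
  have Mq : q%:A != 0 :> M by rewrite in_alg_eq0.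
  apply: (mulfI Mq); rewrite -in_algM mulrC [q * _]mulrC divfK // in_algN mulrC.
  by apply/eqP; rewrite -addr_eq0 addrC; apply/eqP.
case/eqP: (noroot (- p / q)); apply: (@in_alg_inj _ M).
by rewrite in_algD in_algXn in_algM -zu.
Qed.

End QuadraticExtension.

(** The zero ideal is prime, and a closed set containing it is all of Spec. *)
Lemma irreducible_of_field (C : comPzRingType) (M : fieldType)
    (jota : {rmorphism C -> M}) : injective jota -> irreducible [set: spec C]%classic.
Proof.
move=> inj; have j0 a : jota a = 0 -> a = 0 by move=> a0; apply: inj; rewrite a0 rmorph0.
have eta : prime_ideal [set (0 : C)]%classic.
  split=> //= [a b -> ->|a b ->||a b ab]; rewrite ?addr0 ?mulr0 //.
    by move=> /(congr1 jota); rewrite rmorph1 rmorph0; apply/eqP/oner_neq0.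
  have /eqP : jota a * jota b = 0 by rewrite -rmorphM ab rmorph0.
  by rewrite mulf_eq0 => /orP[] /eqP/j0; [left|right].
split; first by exists (Spec eta).
move=> Z1 Z2 [E1 ->] [E2 ->] /(_ (Spec eta) I) h.
have gen E : vanishing E (Spec eta) -> ([set: spec C] `<=` vanishing E)%classic.
  move=> /= E0 P _ x /E0 -> ; exact: spec0.
by case: h => /gen; [left|right].
Qed.

Section FunctionField.
Variables (k : closedFieldType) (C : comPzRingType).
Variables (sigma : {rmorphism laurent k -> C}) (tau : C) (al be : laurent k).
Hypothesis Q : quad_alg sigma tau al be.

Lemma quad_alg_module_finite : module_finite sigma.
Proof.
exists 2, (fun i : 'I_2 => if i == ord0 then 1 else tau) => y.
case: Q => _ sp _; have [a [b ->]] := sp y.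
exists (fun i : 'I_2 => if i == ord0 then a else b).
by rewrite !big_ord_recr big_ord0 /= add0r mulr1.
Qed.

Hypothesis noroot : forall b : laurent k, b ^+ 2 + al * b != be.

(** A root in k(x) would be integral, hence a Laurent polynomial; so the quadratic has no root in
    k(x), is irreducible there, and [M] arises by adjoining a root. *)
Lemma quad_alg_function_field :
  exists (M : fieldExtType {fraction {poly k}}) (jota : {rmorphism C -> M}),
    [/\ function_field sigma jota, \dim {:M} = 2,
        <<1; jota tau>>%VS = fullv &
        jota tau ^+ 2 + (lfrac al)%:A * jota tau = (lfrac be)%:A].
Proof.
have noroot' u : u ^+ 2 + lfrac al * u != lfrac be.
  by apply/eqP => /lfrac_quad_root[b /eqP]; rewrite (negPf (noroot b)).
have irr : irreducible_poly (quad_poly (lfrac al) (lfrac be)).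
  apply: cubic_irreducible => [|u]; first by rewrite size_quad_poly.
  by rewrite /root horner_quad_poly subr_eq0.
have [M dimM [z rz gen]] := irredp_FAdjoin irr; rewrite size_quad_poly in dimM.
have zE : z ^+ 2 + (lfrac al)%:A * z = (lfrac be)%:A.
  by apply/eqP; rewrite -subr_eq0; move: rz; rewrite /root map_quad_poly horner_quad_poly.
have [jota [jA jt]] := @quad_alg_univ _ _ _ _ _ _ Q M (in_alg M \o @lfrac k) z zE.
exists M, jota; rewrite jt; split=> //; case: (Q) => _ sp _.
split=> [||y].
- apply: raddf_inj => y; have [a [b ->]] := sp y => /=.
  rewrite rmorphD rmorphM /= !jA jt /= => /(quad_ext_free zE noroot')[].
  rewrite -!(rmorph0 (@lfrac k)) => /lfrac_inj -> /lfrac_inj ->.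
  by rewrite !rmorph0 mul0r addr0.
- exact: jA.
have [p [q ->]] := quad_ext_span zE gen y.
have [a1 [c1 [_ c10 ->]]] := fraction_coprime p.
have [a2 [c2 [_ c20 ->]]] := fraction_coprime q.
(* Both coordinates are brought to the common denominator c1 c2, which comes from [laurent k]. *)
exists (sigma (lpoly a1 * lpoly c2) + sigma (lpoly a2 * lpoly c1) * tau).
exists (sigma (lpoly c1 * lpoly c2)).
have jc : jota (sigma (lpoly c1 * lpoly c2)) != 0.
  by rewrite jA -rmorphM [X in X != _]/= in_alg_eq0 lfrac_lpoly tofrac_eq0 mulf_neq0.
split=> //; apply: (mulIf jc); rewrite divfK // rmorphD rmorphM /= !jA jt /=.
rewrite mulrDl mulrAC -!in_algM !lfracM; congr (_%:A + _%:A * _).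
  by rewrite mulrA divfK // lfrac_lpoly tofrac_eq0.
by rewrite [lfrac (lpoly c1) * _]mulrC mulrA divfK // lfrac_lpoly tofrac_eq0.
Qed.

Lemma quad_alg_irreducible : irreducible [set: spec C]%classic.
Proof.
have [M [jota [[inj _ _] _ _ _]]] := quad_alg_function_field.
exact: irreducible_of_field inj.
Qed.

(** Squaring is additive in characteristic 2 and tau^2 = be, so the square of every element lies in
    k(x). *)
Lemma quad_alg_purely_inseparable : 2 = 0 :> k -> al = 0 ->
  purely_inseparable_double_covering sigma.
Proof.
move=> k2 al0; split; first exact: quad_alg_module_finite.
have [M [jota [ff dimM gen zE]]] := quad_alg_function_field.
exists M, jota; split=> //; apply/purely_inseparableP => y _.
have M2 : 2 = 0 :> M.
  by rewrite -(rmorph_nat (in_alg M)) -(rmorph_nat (@tofrac {poly k})) -(rmorph_nat polyC) k2 !rmorph0.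
apply/purely_inseparable_elementP_pchar; exists 2.
  by rewrite pnatE // inE /= M2 eqxx.
have [p [q ->]] := quad_ext_span zE gen y.
have -> : (p%:A + q%:A * jota tau) ^+ 2 = (p ^+ 2 + q ^+ 2 * lfrac be)%:A :> M.
  rewrite in_algD in_algM !in_algXn -zE al0 rmorph0 in_alg0 mul0r addr0.
  by rewrite sqrrD -mulr_natl M2 mul0r addr0 exprMn.
by apply/vlineP; exists (p ^+ 2 + q ^+ 2 * lfrac be).
Qed.

(** In characteristic 2 the derivative of T^2 + al T - be is the nonzero constant al. *)
Lemma quad_alg_separable : 2 = 0 :> k -> al != 0 ->
  separable_double_covering sigma.
Proof.
move=> k2 al0; split; first exact: quad_alg_module_finite.
have [M [jota [ff dimM gen zE]]] := quad_alg_function_field.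
exists M, jota; split=> //; apply/separableP => y _.
have M2 : 2 = 0 :> M.
  by rewrite -(rmorph_nat (in_alg M)) -(rmorph_nat (@tofrac {poly k})) -(rmorph_nat polyC) k2 !rmorph0.
have Mal : (lfrac al)%:A != 0 :> M.
  by rewrite in_alg_eq0 -(rmorph0 (@lfrac k)) (inj_eq (@lfrac_inj k)).
suff sepz : separable_element 1 (jota tau).
  by apply: (adjoin_separableP sepz); rewrite gen memvf.
apply/separable_elementP; exists (quad_poly (lfrac al)%:A (lfrac be)%:A); split.
- rewrite -(map_quad_poly (in_alg M)); apply/polyOverP => i; rewrite coef_map /=.
  exact/vlineP/(ex_intro _ _ erefl).
- by rewrite /root horner_quad_poly zE subrr.
- rewrite separable_poly.unlock.
  have -> : (quad_poly (lfrac al)%:A (lfrac be)%:A)^`() = (lfrac al)%:A%:P :> {poly M}.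
    rewrite /quad_poly derivB derivC subr0 derivD derivXn derivM derivC mul0r add0r derivX mulr1 expr1.
    have M2P : 2 = 0 :> {poly M} by rewrite -(rmorph_nat polyC) M2 rmorph0.
    by rewrite -mulr_natl M2P mul0r add0r.
  have alP : ((lfrac al)%:A : M)%:P %= 1 by rewrite polyC_eqp1.
  by rewrite (eqp_coprimepr _ alP) coprimep1.
Qed.

End FunctionField.

(** * The split case: two rational curves *)

Section Split.
Variables (k : closedFieldType) (C : comPzRingType).
Variables (sigma : {rmorphism laurent k -> C}) (tau : C) (al be : laurent k).
Hypothesis Q : quad_alg sigma tau al be.

(** A root [r] in the base defines a retraction [ev] of [sigma] with tau sent to [r]; [P] is its
    kernel, and the quotient by it is the Laurent ring itself. *)
Lemma section_spec r : r ^+ 2 + al * r = be ->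
  exists (P : spec C), [/\ rational_curve sigma P, component_iso sigma P &
    forall a b, spec_val P (sigma a + sigma b * tau) <-> a + b * r = 0].
Proof.
move=> rE; have [ev [evA evt]] := @quad_alg_univ _ _ _ _ _ _ Q _ (idfun : {rmorphism laurent k -> laurent k}) r rE.
have prP : prime_ideal [set y | ev y = 0]%classic.
  split=> /= [|a b|a b|/eqP|a b].
  - exact: rmorph0.
  - by rewrite rmorphD => -> ->; rewrite addr0.
  - by rewrite rmorphM => ->; rewrite mulr0.
  - by rewrite rmorph1 oner_eq0.
  - by rewrite rmorphM => /laurent_eq0.
pose P : spec C := Spec prP.
exists P; split=> [||a b]; last by rewrite /= rmorphD rmorphM /= !evA evt.
  exists (@lfrac k \o ev); split=> [c|y|u] /=.
  - by rewrite evA /= lfrac_lC.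
  - by split=> [|->]; rewrite ?rmorph0 // -(rmorph0 (@lfrac k)) => /lfrac_inj.
  - have [p [q [_ q0 ->]]] := fraction_coprime u.
    exists (sigma (lpoly p)), (sigma (lpoly q)); rewrite !evA /=; split=> //.
    by rewrite lfrac_lpoly tofrac_eq0.
have evI y : y \in ideal_gen (spec_val P) -> ev y = 0.
  move=> /asboolP[s [sP ->]]; rewrite rmorph_sum big1_seq // => p /andP[_ /sP /= ep].
  by rewrite rmorphM /= ep mulr0.
have /choice[g gE] : forall y : quotient (spec_val P), exists a, quot_pi (spec_val P) (sigma a) = y.
  move=> y; exists (ev (repr (y : {ideal_quot ideal_gen (spec_val P)})%qT)).
  rewrite -[RHS]quot_pi_repr; apply/quot_piE/mem_ideal_gen => /=.
  by rewrite rmorphB evA subrr.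
exists g => [a|y]; last exact: gE.
have /quot_piE/evI := gE (quot_pi (spec_val P) (sigma a)).
by rewrite -rmorphB evA /= => /eqP; rewrite subr_eq0 => /eqP.
Qed.

(** The roots are 0 and [- al]. As (al + tau) tau = 0, every prime contains a factor and thus [P1]
    or [P2]; neither of these contains the other because [al != 0]. *)
Lemma split_two_curves : be = 0 -> al != 0 ->
  exists P1 P2 : spec C,
    [/\ two_rational_curves sigma P1 P2, component_iso sigma P1 & component_iso sigma P2].
Proof.
move=> be0 al0.
have [|P1 [rat1 iso1 P1E]] := @section_spec 0; first by rewrite expr0n mulr0 addr0 be0.
have [|P2 [rat2 iso2 P2E]] := @section_spec (- al); first by rewrite sqrrN mulrN -expr2 subrr be0.
have P1t : spec_val P1 tau.
  have -> : tau = sigma 0 + sigma 1 * tau by rewrite rmorph0 rmorph1 mul1r add0r.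
  by apply/P1E; rewrite mulr0 addr0.
have P2t : spec_val P2 (sigma al + tau).
  have -> : sigma al + tau = sigma al + sigma 1 * tau by rewrite rmorph1 mul1r.
  by apply/P2E; rewrite mul1r subrr.
have P1nt : ~ spec_val P1 (sigma al + tau).
  have -> : sigma al + tau = sigma al + sigma 1 * tau by rewrite rmorph1 mul1r.
  by move=> /P1E; rewrite mulr0 addr0; apply/eqP.
have P2nt : ~ spec_val P2 tau.
  have -> : tau = sigma 0 + sigma 1 * tau by rewrite rmorph0 rmorph1 mul1r add0r.
  by move=> /P2E /eqP; rewrite mul1r add0r oppr_eq0 (negPf al0).
have in1 (P : spec C) y : spec_val P tau -> spec_val P1 y -> spec_val P y.
  case: Q => _ sp _; have [a [b ->]] := sp y => Pt /P1E; rewrite mulr0 addr0 => ->.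
  by rewrite rmorph0 add0r; apply: specMl.
have in2 (P : spec C) y : spec_val P (sigma al + tau) -> spec_val P2 y -> spec_val P y.
  case: Q => _ sp _; have [a [b ->]] := sp y => Pt /P2E /eqP; rewrite mulrN subr_eq0 => /eqP ->.
  by rewrite rmorphM -mulrDr; apply: specMl.
have cover : (vanishing (spec_val P1) `|` vanishing (spec_val P2))%classic = setT.
  apply/seteqP; split=> // P _.
  have : spec_val P ((sigma al + tau) * tau).
    case: Q => rel _ _; rewrite mulrDl addrC -expr2 rel be0 rmorph0; exact: spec0.
  by case/spec_prime => Pt; [right|left] => y; [apply: in2|apply: in1].
have irr (P : spec C) : irreducible (vanishing (spec_val P)).
  split; first by exists P.
  move=> Z1 Z2 [E1 ->] [E2 ->] /(_ P (fun _ => id)) h.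
  have gen E : vanishing E P -> (vanishing (spec_val P) `<=` vanishing E)%classic.
    by move=> EP P' PP' x /EP /PP'.
  by case: h => /gen; [left|right].
have closedV (P : spec C) : zariski_closed (vanishing (spec_val P)) by exists (spec_val P).
have sub Z : irreducible Z -> (Z `<=` vanishing (spec_val P1))%classic \/
    (Z `<=` vanishing (spec_val P2))%classic.
  by case=> _; apply => //; rewrite cover.
have comp (P P' : spec C) : ~ vanishing (spec_val P') P ->
    (forall Z, irreducible Z -> (Z `<=` vanishing (spec_val P))%classic \/
      (Z `<=` vanishing (spec_val P'))%classic) ->
    irreducible_component (vanishing (spec_val P)).
  move=> PP' sub'; split=> // Z irrZ sZ; apply/seteqP; split=> //.
  by case: (sub' Z irrZ) => // h; case: PP'; apply: h; apply: sZ => x.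
have comp1 : irreducible_component (vanishing (spec_val P1)).
  by apply: (comp _ P2) => // h; apply: P1nt; apply: h.
have comp2 : irreducible_component (vanishing (spec_val P2)).
  by apply: (comp _ P1) => [h|Z /sub[]]; [apply: P2nt; apply: h|right|left].
exists P1, P2; split=> //; split=> //.
  by move=> P12; apply: P2nt; rewrite -P12.
move=> Z; split=> [[_ irrZ maxZ]|[->|->]] //.
by case: (sub Z irrZ) => h; [left|right]; apply/esym/maxZ => //; apply: irr.
Qed.

End Split.

(** * Gauss valuations *)

Section RatValuation.
Variables (RR : realType) (K : fieldType) (v : K -> \bar RR).
Hypothesis hv : is_rat_valuation v.
Local Open Scope ereal_scope.

Lemma rat_val0 : v 0%R = +oo. Proof. by case: hv. Qed.
Lemma rat_valE x : x != 0%R -> exists q : rat, v x = (ratr q)%:E.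
Proof. by case: hv => _ h _ _; apply: h. Qed.
Lemma rat_valM x y : v (x * y)%R = v x + v y. Proof. by case: hv. Qed.

Lemma rat_val1 : v 1%R = 0.
Proof.
have [q qE] := rat_valE (oner_neq0 K).
have := rat_valM 1%R 1%R; rewrite mulr1 qE -EFinD => -[] /eqP.
by rewrite -subr_eq0 opprD addrA subrr sub0r oppr_eq0 => /eqP ->.
Qed.

Lemma rat_valV x q : x != 0%R -> v x = (ratr q)%:E -> v x^-1%R = (- ratr q)%:E.
Proof.
move=> x0 xq; have [q' q'E] := rat_valE (invr_neq0 x0).
have := rat_valM x x^-1%R; rewrite divff // rat_val1 xq q'E -EFinD => -[] /esym/eqP.
by rewrite addrC addr_eq0 => /eqP ->.
Qed.

(** Supports are finite and all other coefficients have valuation +oo, so the infimum in [gauss_val]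
    is a minimum. *)
Lemma gauss_attained (u : laurent K) : u != 0%R -> exists2 i, lcoef i u != 0%R &
  forall l, v (lcoef i u) <= v (lcoef l u).
Proof.
move=> u0.
have min_seq (s : seq int) : s != [::] ->
    exists2 i, i \in s & forall l, l \in s -> v (lcoef i u) <= v (lcoef l u).
  elim: s => // i [|i' s] IHs _.
    by exists i => [|l]; rewrite inE // => /eqP ->.
  have [//|m ms mmin] := IHs; have [im|mi] := leP (v (lcoef i u)) (v (lcoef m u)).
    exists i => [|l]; rewrite inE ?eqxx // => /orP[/eqP -> //|ls].
    exact: le_trans im (mmin l ls).
  exists m => [|l]; rewrite inE ?ms ?orbT // => /orP[/eqP ->|/mmin //].
  exact: ltW.
have [|i iu imin] := min_seq (enum_fset (lsupp u)).
  by apply: contra u0 => /eqP s0; apply/eqP; rewrite [u]laurentE s0 big_nil.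
exists i => [|l]; first by rewrite -mem_lsupp.
have [lu|lu] := boolP (l \in lsupp u); first exact: imin.
by rewrite (lcoef_out lu) rat_val0 leey.
Qed.

Lemma gauss_valE (u : laurent K) : u != 0%R ->
  exists2 i, lcoef i u != 0%R & gauss_val v u = v (lcoef i u).
Proof.
move=> /gauss_attained[i i0 imin]; exists i => //; apply/eqP; rewrite eq_le.
apply/andP; split; first by apply: ereal_inf_lbound; exists i.
by apply: le_ereal_inf_tmp => _ [l _ <-].
Qed.

Lemma gauss_val_ge r (u : laurent K) :
  r <= gauss_val v u <-> forall i, r <= v (lcoef i u).
Proof.
split=> [ru i|ru]; first by apply: le_trans ru _; apply: ereal_inf_lbound; exists i.
by apply: le_ereal_inf_tmp => _ [l _ <-].
Qed.

Lemma gauss_val0 : gauss_val v 0%R = +oo.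
Proof.
apply/eqP; rewrite eq_le leey /=; apply/gauss_val_ge => i.
by rewrite lcoef0 rat_val0.
Qed.

(** Strict bounds pass to the infimum because it is attained, or is +oo for the zero polynomial. *)
Lemma gauss_val_gt (r : RR) (u : laurent K) :
  r%:E < gauss_val v u <-> forall i, r%:E < v (lcoef i u).
Proof.
split=> [ru i|ru]; first by apply: lt_le_trans ru _; apply: ereal_inf_lbound; exists i.
have [->|/gauss_valE[i _ ->]] := eqVneq u 0%R; first by rewrite gauss_val0 ltry.
exact: ru.
Qed.

Lemma laurent_min2 (a b : laurent K) : ~ (a = 0%R /\ b = 0%R) -> exists c,
  [/\ c != 0%R, forall i, v c <= v (lcoef i a), forall i, v c <= v (lcoef i b) &
      exists i, v (lcoef i a) = v c \/ v (lcoef i b) = v c].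
Proof.
have small c : v 0%R = +oo -> forall i, v c <= v (lcoef i (0%R : laurent K)).
  by move=> h i; rewrite lcoef0 h leey.
have /small v0 := rat_val0.
have [->|/gauss_attained[i i0 imin]] := eqVneq a 0%R.
  have [-> []//|/gauss_attained[i i0 imin] _] := eqVneq b 0%R.
  by exists (lcoef i b); split => //; exists i; right.
have [-> _|/gauss_attained[l l0 lmin] _] := eqVneq b 0%R.
  by exists (lcoef i a); split => //; exists i; left.
have [il|/ltW li] := leP (v (lcoef i a)) (v (lcoef l b)).
  exists (lcoef i a); split=> // [m|]; last by exists i; left.
  exact: le_trans il (lmin m).
exists (lcoef l b); split=> // [m|]; last by exists l; right.
exact: le_trans li (imin m).
Qed.

End RatValuation.

(* R is only used through its embedding j in K as the valuation ring of v, and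
   k only through the reduction map res. *)
Section ValuationRing.
Variables (RR : realType) (K : fieldType) (v : K -> \bar RR).
Variables (R : comNzRingType) (k : fieldType).
Variables (j : {rmorphism R -> K}) (res : {rmorphism R -> k}).
Hypothesis hv : is_rat_valuation v.
Hypothesis j_inj : injective j.
Hypothesis hR : forall u : K, (0 <= v u)%E <-> exists r, j r = u.
Hypothesis hres : forall r, res r = 0 <-> (0 < v (j r))%E.
Implicit Types a b : laurent R.

Lemma laurent_integral_lift (u : laurent K) : (forall i, 0 <= v (lcoef i u))%E ->
  exists a, lmap j a = u.
Proof.
move=> u0; have /choice[lift liftK] : forall i, exists r, j r = lcoef i u.
  by move=> i; apply/hR.
exists (\sum_(i <- lsupp u) lmono i (lift i)).
rewrite rmorph_sum [RHS]laurentE; apply: eq_bigr => i _ /=.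
by rewrite lmap_lmono liftK.
Qed.

Lemma lmap_res_eq0 a : lmap res a = 0 <-> forall i, (0 < v (lcoef i (lmap j a)))%E.
Proof.
split=> [a0 i|a0].
  by rewrite lcoef_lmap; apply/hres; rewrite -lcoef_lmap a0 lcoef0.
by apply/laurentP => i; rewrite lcoef_lmap lcoef0; apply/hres; rewrite -lcoef_lmap.
Qed.

(** Over a valuation ring the content of the pair is generated by a coefficient [c] of least
    valuation; after division by [c], the coefficient where this valuation occurs has nonzero
    residue. *)
Lemma laurent_normalize (u w : laurent K) : ~ (u = 0 /\ w = 0) -> exists c a b,
  [/\ c != 0, u = lC c * lmap j a, w = lC c * lmap j b &
      ~ (lmap res a = 0 /\ lmap res b = 0)].
Proof.
move=> /(laurent_min2 hv)[c [c0 cu cw cuw]].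
have [q cq] := rat_valE hv c0; have cV := rat_valV hv c0 cq.
have lift (x : laurent K) : (forall i, v c <= v (lcoef i x))%E ->
    exists a, x = lC c * lmap j a.
  move=> cx; have [i|a aE] := @laurent_integral_lift (lC c^-1 * x).
    rewrite lcoef_lCM (rat_valM hv) cV EFinN addeC.
    by rewrite sube_ge0 ?fin_numE // -cq.
  by exists a; rewrite aE mulrA -rmorphM /= divff // rmorph1 mul1r.
have [a aE] := lift u cu; have [b bE] := lift w cw.
exists c, a, b; split=> // -[a0 b0].
(* As v(c) is finite, v(c) + s = v(c) forces s = 0, whereas a zero residue makes s positive. *)
have ne (x : laurent K) d i : x = lC c * lmap j d -> lmap res d = 0 -> v (lcoef i x) <> v c.
  move=> -> /lmap_res_eq0/(_ i) d0; rewrite lcoef_lCM (rat_valM hv) cq => e.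
  move: e d0.
  case: (v (lcoef i (lmap j d))) => [s||] //= [] /eqP.
  by rewrite addrC -subr_eq0 addrK => /eqP ->; rewrite ltxx.
by case: cuw => i [/(ne _ _ _ aE a0)|/(ne _ _ _ bE b0)].
Qed.

Lemma valuation_ring_or c : c != 0 ->
  (exists r, j r = c) \/ exists2 r, j r = c^-1 & res r = 0.
Proof.
move=> c0; have [q cq] := rat_valE hv c0.
have [ge0|lt0] := leP 0%E (v c); first by left; apply/hR.
have cV := rat_valV hv c0 cq.
have Vgt0 : (0 < v c^-1)%E by move: lt0; rewrite cV cq !lte_fin oppr_gt0.
have [r rE] := proj1 (hR c^-1) (ltW Vgt0).
by right; exists r => //; apply/hres; rewrite rE.
Qed.

(** Write u = c a with [a] nonzero. If c is not in [R], then r = c^-1 lies in the maximal ideal;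
    multiplying the equation by r^n leaves a^n plus multiples of r, so [a]^n = 0, a
    contradiction. *)
Lemma integral_lmap u : integralOver (lmap j) u -> exists a, u = lmap j a.
Proof.
case=> P monP.
have [->|/eqP u0] := eqVneq u 0; first by exists 0; rewrite rmorph0.
(* Pairing with 0 makes [b] zero too, so the nonzero residue is that of [a]. *)
have [[]//|c [a [b [c0 uE bE ab0]]]] := @laurent_normalize u 0.
have [[r rE] _|[r rE r0]] := valuation_ring_or c0.
  by exists (lC r * a); rewrite rmorphM /= lmap_lmono rE.
rewrite /root horner_coef (size_map_inj_poly (lmap_inj j_inj)) ?rmorph0 //.
case szP: (size P) => [|n].
  by move: monP; rewrite monicE /lead_coef szP nth_default ?szP // eq_sym oner_eq0.
rewrite big_ord_recr /= => /eqP.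
have -> : (map_poly (lmap j) P)`_n = 1.
  rewrite coef_map; move: monP; rewrite monicE /lead_coef szP => /eqP /= ->.
  by rewrite rmorph1.
move/(congr1 (fun x => lC (j r) ^+ n * x)); rewrite mulr0 mulrDr mulr_sumr.
have rc : lC (j r) * lC c = 1 by rewrite rE -rmorphM mulVf // rmorph1.
have scale (x y p w : laurent K) i : x * y = 1 -> (i <= n)%N ->
    x ^+ n * (p * (y * w) ^+ i) = p * w ^+ i * x ^+ (n - i).
  move=> xy le_in; rewrite -{1}(subnK le_in) exprD exprMn.
  have xyi : x ^+ i * y ^+ i = 1 by rewrite -exprMn xy expr1n.
  transitivity (p * w ^+ i * x ^+ (n - i) * (x ^+ i * y ^+ i)); last by rewrite xyi mulr1.
  by move: (x ^+ i) (y ^+ i) (w ^+ i) (x ^+ (n - i)) => *; ring.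
rewrite uE scale // subnn expr0 mulr1 mul1r.
have -> : \sum_(i < n) lC (j r) ^+ n * ((map_poly (lmap j) P)`_i * (lC c * lmap j a) ^+ i) =
    lmap j (\sum_(i < n) P`_i * a ^+ i * lC r ^+ (n - i)).
  rewrite rmorph_sum; apply: eq_bigr => i _; rewrite scale ?(ltnW (ltn_ord i)) //.
  by rewrite coef_map !rmorphM !rmorphXn /= lmap_lmono.
rewrite -rmorphXn -rmorphD -(rmorph0 (lmap j)) => /(lmap_inj j_inj)/(congr1 (lmap res)).
rewrite rmorphD rmorph_sum big1 => [|i _]; last first.
  rewrite rmorphM rmorphXn /= lmap_lmono r0 lmono0.
  by rewrite expr0n subn_eq0 leqNgt ltn_ord mulr0.
rewrite add0r rmorphXn rmorph0 /= => an0.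
suff a0 : lmap res a = 0.
  case: ab0; split=> //; suff -> : b = 0 by rewrite rmorph0.
  apply: (lmap_inj j_inj); rewrite rmorph0 -[LHS]mul1r -rc -mulrA -bE mulr0.
  by [].
elim: n an0 {szP scale} => [/eqP|n IHn]; first by rewrite expr0 oner_eq0.
by rewrite exprS => /laurent_eq0[].
Qed.

End ValuationRing.

(** * Flatness and normalization *)

Section Flatness.
Variables (R N : comNzRingType) (phi : {rmorphism R -> N}).
Variables (I : eqType) (e : I -> N) (c : I -> N -> R).
Hypothesis cD : forall i, {morph c i : m n / m + n}.
Hypothesis cZ : forall i r n, c i (phi r * n) = r * c i n.
Hypothesis c_span : forall ns : seq N, exists s : seq I,
  forall n, n \in ns -> n = \sum_(i <- s) phi (c i n) * e i.

(* Freeness kills tensors one coordinate at a time: (m, n) |-> c_i(n) m is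
   balanced. *)
Lemma flat_of_coords : flat phi.
Proof.
move=> M M' u u_inj s su0.
have coord0 i : \sum_(p <- s) c i p.2 *: p.1 = 0.
  apply: u_inj; rewrite raddf0 raddf_sum.
  pose beta (m : M) (n : N) := c i n *: m.
  have /su0 : balanced phi beta.
    split=> [m m' n|m n n'|r m n]; rewrite /beta.
    - exact: scalerDr.
    - by rewrite cD scalerDl.
    - by rewrite cZ scalerA mulrC.
  move=> beta0; rewrite -[RHS]beta0 big_map; apply: eq_bigr => p _.
  by rewrite /beta /= linearZ.
move=> P beta [bDl bDr bZ].
have b0l n : beta 0 n = 0.
  by have /esym/eqP := bDl 0 0 n; rewrite addr0 -subr_eq0 addrK => /eqP.
have b0r m : beta m 0 = 0.
  by have /esym/eqP := bDr m 0 0; rewrite addr0 -subr_eq0 addrK => /eqP.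
have [S SE] := c_span (unzip2 s).
have -> : \sum_(p <- s) beta p.1 p.2 = \sum_(i <- S) beta (\sum_(p <- s) c i p.2 *: p.1) (e i).
  have -> : \sum_(p <- s) beta p.1 p.2 =
      \sum_(p <- s) \sum_(i <- S) beta (c i p.2 *: p.1) (e i).
    apply: eq_big_seq => p ps; rewrite [in LHS](SE p.2) ?map_f //.
    rewrite (big_morph _ (bDr p.1) (b0r p.1)); apply: eq_bigr => i _.
    by rewrite bZ.
  rewrite exchange_big; apply: eq_bigr => i _ /=.
  by rewrite (big_morph (beta^~ (e i)) (fun m m' => bDl m m' (e i)) (b0l (e i))).
by rewrite big1 // => i _; rewrite coord0 b0l.
Qed.
End Flatness.

Section QuadAlgFree.
Variables (R N : comNzRingType) (sigma : {rmorphism laurent R -> N}) (tau : N).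
Variables (al be : laurent R).
Hypothesis Q : quad_alg sigma tau al be.

(** As an [R]-module [N] has the basis x^l and x^l tau, indexed by [int + int]; finitely many
    elements involve finitely many basis vectors. *)
Lemma quad_alg_flat : flat (sigma \o @lC R).
Proof.
case: (Q) => _ sp _.
have /choice[ab abE] : forall y, exists p : laurent R * laurent R,
    y = sigma p.1 + sigma p.2 * tau.
  by move=> y; have [a [b ->]] := sp y; exists (a, b).
have ab_uniq a b : ab (sigma a + sigma b * tau) = (a, b).
  have [aE bE] := quad_alg_uniq Q (abE (sigma a + sigma b * tau)).
  by rewrite [LHS]surjective_pairing -aE -bE.
pose c (i : int + int) (n : N) : R :=
  match i with inl l => lcoef l (ab n).1 | inr l => lcoef l (ab n).2 end.
pose e (i : int + int) : N :=
  match i with inl l => sigma (lmono l 1) | inr l => sigma (lmono l 1) * tau end.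
apply: (@flat_of_coords _ _ _ _ e c) => [i m n|i r n|ns].
- rewrite /c; have -> : ab (m + n) = ((ab m).1 + (ab n).1, (ab m).2 + (ab n).2).
    by rewrite {1}[m]abE {1}[n]abE addrACA -mulrDl -!rmorphD ab_uniq.
  by case: i => l /=; rewrite lcoefD.
- rewrite /c; have -> : ab ((sigma \o @lC R) r * n) = (lC r * (ab n).1, lC r * (ab n).2).
    by rewrite {1}[n]abE mulrDr mulrA /= -!rmorphM ab_uniq.
  by case: i => l /=; rewrite lcoef_lCM.
have [d dE] : exists d : {fset int}, forall n, n \in ns ->
    (lsupp (ab n).1 `<=` d)%fset /\ (lsupp (ab n).2 `<=` d)%fset.
  elim: ns => [|n ns [d dE]]; first by exists fset0.
  exists (d `|` (lsupp (ab n).1 `|` lsupp (ab n).2))%fset => m.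
  rewrite inE => /orP[/eqP ->|/dE[d1 d2]].
    by split; apply: fsubset_trans (fsubsetUr _ _); rewrite ?fsubsetUl ?fsubsetUr.
  by split; apply: fsubset_trans (fsubsetUl _ _).
exists (map inl (enum_fset d) ++ map inr (enum_fset d)) => n /dE[d1 d2].
rewrite big_cat !big_map /= {1}[n]abE.
rewrite {1}(laurentEw d1) {1}(laurentEw d2) !rmorph_sum mulr_suml /=.
congr (_ + _); apply: eq_bigr => l _; rewrite lmono_lC rmorphM //.
by rewrite mulrA.
Qed.
End QuadAlgFree.

Lemma quad_alg_iso (A : comNzRingType) (C C' : comPzRingType)
    (sigma : {rmorphism A -> C}) (sigma' : {rmorphism A -> C'}) tau tau' al be :
  quad_alg sigma tau al be -> quad_alg sigma' tau' al be ->
  exists phi : {rmorphism C -> C'},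
    [/\ bijective phi, forall a, phi (sigma a) = sigma' a & phi tau = tau'].
Proof.
move=> Q Q'; case: (Q) (Q') => rel sp _ [rel' sp' _].
have [phi [phiA phit]] := quad_alg_univ Q rel'.
have [psi [psiA psit]] := quad_alg_univ Q' rel.
exists phi; split=> //; exists psi => y.
  by have [a [b ->]] := sp y; rewrite !rmorphD !rmorphM /= !phiA phit !psiA psit.
by have [a [b ->]] := sp' y; rewrite !rmorphD !rmorphM /= !psiA psit !phiA phit.
Qed.

(** Conjugation without constructing an automorphism: evaluation at p + q z and p - q z gives U + V
    z and U - V z with the same U, V, and U + V z = 0 forces U = V = 0. *)
Lemma conj_root (F : fieldType) (M : fieldExtType F) (z : M) (b p q : F) (P : {poly F}) :
  (forall u : F, u ^+ 2 != b) -> z ^+ 2 = b%:A ->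
  root (map_poly (in_alg M) P) (p%:A + q%:A * z) ->
  root (map_poly (in_alg M) P) (p%:A - q%:A * z).
Proof.
move=> nsq zE; have [U [V [EU ->]]] : exists U V : F,
    (map_poly (in_alg M) P).[p%:A + q%:A * z] = U%:A + V%:A * z /\
    root (map_poly (in_alg M) P) (p%:A - q%:A * z) = (U%:A - V%:A * z == 0).
  rewrite /root; suff [U [V [-> ->]]] : exists U V : F,
      (map_poly (in_alg M) P).[p%:A + q%:A * z] = U%:A + V%:A * z /\
      (map_poly (in_alg M) P).[p%:A - q%:A * z] = U%:A - V%:A * z by exists U, V.
  elim/poly_ind: P => [|P c [U [V [E1 E2]]]].
    by exists 0, 0; rewrite rmorph0 !horner0 in_alg0 mul0r subr0 addr0.
  exists (U * p + V * q * b + c), (U * q + V * p).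
  rewrite rmorphD rmorphM /= map_polyX map_polyC !hornerE E1 E2.
  rewrite !in_algD !in_algM -zE /=.
  move: (U%:A) (V%:A) (p%:A) (q%:A) (c%:A) => *; split; ring.
rewrite /root EU => /eqP.
case/(@quad_ext_free _ _ _ 0 b); first by rewrite in_alg0 mul0r addr0.
  by move=> u; rewrite mul0r addr0.
by move=> -> ->; rewrite in_alg0 mul0r subr0.
Qed.

(** * The normalization, with c = 2^(gamma/2), h' = 2^(1-gamma/2) h and g' = g/2^gamma *)

Section Normalization.
Variables (RR : realType) (K : fieldType) (v : K -> \bar RR).
Variables (R : comNzRingType) (k : fieldType).
Variables (j : {rmorphism R -> K}) (res : {rmorphism R -> k}).
Hypothesis hv : is_rat_valuation v.
Hypothesis j_inj : injective j.
Hypothesis hR : forall u : K, (0 <= v u)%E <-> exists r, j r = u.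
Hypothesis hres : forall r, res r = 0 <-> (0 < v (j r))%E.
Hypothesis K2 : 2 != 0 :> K.
Hypothesis k2 : 2 = 0 :> k.
Variables (L : fieldExtType {fraction {poly K}}) (z t : L).
Variables (f g h g' h' : laurent R) (c : K).
Hypothesis f_nsq : ~ (exists p : laurent K, lmap j f = p ^+ 2).
Hypothesis f_sqfree :
  forall p q : laurent K, lmap j f = p ^+ 2 * q -> exists p', p * p' = 1.
Hypothesis zE : z ^+ 2 = toL j L f.
Hypothesis zgen : <<1; z>>%VS = fullv.
Hypothesis fE : f = h ^+ 2 + g.
Hypothesis c0 : c != 0.
Hypothesis h'E : lC c * lmap j h' = 2 * lmap j h.
Hypothesis g'E : lC c ^+ 2 * lmap j g' = lmap j g.
Hypothesis ztE : z = toL j L h + (lfrac (lC c))%:A * t.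
Hypothesis norm_ker : forall a b : laurent k, b * lmap res h' = 0 ->
  a ^+ 2 = a * b * lmap res h' + b ^+ 2 * lmap res g' -> a = 0 /\ b = 0.
Local Notation F := (lfrac (lmap j f)).
Local Notation jl := (@lfrac K \o lmap j).

(** Two stages: K[x^{+-1}] is integrally closed in K(x), and R[x^{+-1}] in K[x^{+-1}]. *)
Lemma integral_jl u : integralOver jl u -> exists a, u = lfrac (lmap j a).
Proof.
case=> P monP rP; have [|b bE] := @integral_lfrac _ u.
  exists (map_poly (lmap j) P); first exact: monic_map.
  by rewrite -map_poly_comp.
have [|a aE] := @integral_lmap _ _ _ _ _ _ _ hv j_inj hR hres b.
  exists P => //; move: rP; rewrite bE map_poly_comp /root horner_map /=.
  by rewrite -{1}(rmorph0 (@lfrac K)) (inj_eq (@lfrac_inj K)).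
by exists a; rewrite bE aE.
Qed.

Lemma integral_toL u : integralOver (toL j L) u%:A -> integralOver jl u.
Proof.
case=> P monP rP; exists P => //; move: rP.
by rewrite /toL map_poly_comp (fmorph_root (in_alg L)).
Qed.

Lemma F_nsq u : u ^+ 2 != F.
Proof. by apply/eqP => /lfrac_sqrt[b fb _]; apply: f_nsq; exists b. Qed.

Lemma toLE a : toL j L a = (lfrac (lmap j a))%:A. Proof. by []. Qed.

(** Multiplied by c^2, the left side becomes (c t)^2 + 2 h (c t) = z^2 - h^2. *)
Lemma t_rel : t ^+ 2 + toL j L h' * t = toL j L g'.
Proof.
have cL : (lfrac (lC c))%:A != 0 :> L.
  by rewrite in_alg_eq0 lfrac_lC tofrac_eq0 polyC_eq0.
have h'L : (lfrac (lC c))%:A * toL j L h' = 2 * toL j L h.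
  by rewrite !toLE -in_algM -lfracM h'E !lfracM in_algM !rmorph_nat -[2 in RHS](rmorph_nat (in_alg L)).
have g'L : (lfrac (lC c))%:A ^+ 2 * toL j L g' = toL j L g.
  by rewrite !toLE -in_algXn -in_algM -rmorphXn -lfracM g'E.
apply: (mulfI (expf_neq0 2 cL)); rewrite g'L.
have -> : toL j L g = z ^+ 2 - toL j L h ^+ 2 by rewrite zE fE rmorphD rmorphXn /= addrC addKr.
have -> : (lfrac (lC c))%:A ^+ 2 * (t ^+ 2 + toL j L h' * t) =
  (lfrac (lC c))%:A ^+ 2 * t ^+ 2 + ((lfrac (lC c))%:A * toL j L h') * ((lfrac (lC c))%:A * t).
  by move: (toL j L h') (_%:A) => *; ring.
by rewrite h'L ztE; move: (toL j L h) (_%:A) => *; ring.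
Qed.

(** A root u in K(x) of the equation of t would make h + c u a square root of [f]. *)
Lemma t_free a b : toL j L a + toL j L b * t = 0 -> a = 0 /\ b = 0.
Proof.
have no_root u : u ^+ 2 + lfrac (lmap j h') * u != lfrac (lmap j g').
  apply/eqP => uE; case/eqP: (F_nsq (lfrac (lmap j h) + lfrac (lC c) * u)).
  rewrite fE rmorphD rmorphXn /= -g'E [RHS]rmorphD /= lfracM !rmorphXn /= -uE.
  have h'F : lfrac (lC c) * lfrac (lmap j h') = 2 * lfrac (lmap j h).
    by rewrite -lfracM h'E lfracM rmorph_nat.
  have -> : lfrac (lC c) ^+ 2 * (u ^+ 2 + lfrac (lmap j h') * u) =
     lfrac (lC c) ^+ 2 * u ^+ 2 + (lfrac (lC c) * lfrac (lmap j h')) * (lfrac (lC c) * u).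
    by move: (lfrac _) (lfrac _) => *; ring.
  by rewrite h'F; move: (lfrac _) (lfrac _) => *; ring.
rewrite !toLE => /(quad_ext_free t_rel no_root)[].
by rewrite -!(rmorph0 jl) => /lfrac_inj/(lmap_inj j_inj) -> /lfrac_inj/(lmap_inj j_inj) ->.
Qed.

(** Trace 2 p and norm p^2 - q^2 f are integral. Hence (2 q)^2 f, being the squared trace minus 4
    times the norm, is a Laurent polynomial; squarefreeness puts 2 q in K[x^{+-1}], and 2 is
    invertible in [K]. *)
Lemma integral_split y : integralOver (toL j L) y ->
  exists a b T N : laurent K, [/\ y = (lfrac a)%:A + (lfrac b)%:A * z,
    (exists T', T = lmap j T') /\ (exists N', N = lmap j N'), 2 * a = T &
    a ^+ 2 - b ^+ 2 * lmap j f = N].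
Proof.
have zE' : z ^+ 2 + (0 : {fraction {poly K}})%:A * z = F%:A.
  by rewrite in_alg0 mul0r addr0 zE.
have [p [q ->]] := quad_ext_span zE' zgen y => int_y.
have int_y' : integralOver (toL j L) (p%:A - q%:A * z).
  case: int_y => P monP; rewrite /toL map_poly_comp => rP; exists P => //.
  by rewrite map_poly_comp; apply: (@conj_root _ _ _ F _ _ _ F_nsq _ rP).
have [|T' T'E] := @integral_jl (2 * p).
  apply: integral_toL; have := integral_add int_y int_y'.
  by rewrite addrACA subrr addr0 -in_algD -mulr2n mulr_natl.
have [|N' N'E] := @integral_jl (p ^+ 2 - q ^+ 2 * F).
  apply: integral_toL; have := integral_mul int_y int_y'.
  rewrite in_algD in_algN in_algXn in_algM in_algXn -toLE -zE.
  by congr (integralOver _ _); move: (p%:A) (q%:A) => *; ring.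
have [|b0 b0E] := @lfrac_squarefree _ (lmap j f) (2 * q) (lmap j (T' ^+ 2 - 4 * N')) f_sqfree.
  rewrite rmorphB rmorphXn rmorphM rmorph_nat /= rmorphB rmorphXn rmorphM rmorph_nat /= -T'E -N'E.
  by move: (F) => *; ring.
have two_inv : lC 2^-1 * 2 = 1 :> laurent K.
  by rewrite -(rmorph_nat (@lC K)) -rmorphM /= mulVf // rmorph1.
have half (u : {fraction {poly K}}) (w : laurent K) : 2 * u = lfrac w -> u = lfrac (lC 2^-1 * w).
  move=> uw; rewrite lfracM -uw mulrA -(rmorph_nat (@lfrac K)) -lfracM two_inv.
  by rewrite rmorph1 mul1r.
have pE := half _ _ T'E; have qE := half _ _ b0E.
exists (lC 2^-1 * lmap j T'), (lC 2^-1 * b0), (lmap j T'), (lmap j N'); split.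
- by rewrite -pE -qE.
- by split; [exists T'|exists N'].
- by rewrite mulrA [2 * _]mulrC two_inv mul1r.
- apply: lfrac_inj; rewrite rmorphB rmorphXn /= -pE rmorphM rmorphXn /= -qE.
  exact: N'E.
Qed.

Lemma t_span y : integralOver (toL j L) y -> exists a b, y = toL j L a + toL j L b * t.
Proof.
case/integral_split => A [B [T [N [-> [[T' TE] [N' NE]] A2 AN]]]].
(* Substituting z = h + c t passes from the basis 1, z to 1, t; [tr1] and [nr1] express trace and
   norm in the new coordinates. *)
pose a1 := A + B * lmap j h; pose b1 := B * lC c.
have -> : (lfrac A)%:A + (lfrac B)%:A * z = (lfrac a1)%:A + (lfrac b1)%:A * t :> L.
  rewrite /a1 /b1 rmorphD /= !lfracM in_algD !in_algM ztE toLE.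
  by move: (_%:A) (_%:A) (_%:A) (_%:A) => *; ring.
have tr1 : 2 * a1 - b1 * lmap j h' = T.
  by rewrite /b1 -mulrA h'E /a1 -A2; move: (lmap j h) => *; ring.
have nr1 : a1 ^+ 2 - a1 * b1 * lmap j h' - b1 ^+ 2 * lmap j g' = N.
  have -> : a1 * b1 * lmap j h' = a1 * B * (lC c * lmap j h') by rewrite /b1 !mulrA.
  have -> : b1 ^+ 2 * lmap j g' = B ^+ 2 * (lC c ^+ 2 * lmap j g') by rewrite /b1 exprMn !mulrA.
  rewrite h'E g'E -AN fE rmorphD rmorphXn /= /a1.
  by move: (lmap j h) (lmap j g) => *; ring.
have [[a10 b10]|ab10] := pselect (a1 = 0 /\ b1 = 0).
  by exists 0, 0; rewrite !rmorph0 a10 b10 rmorph0 in_alg0 !mul0r.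
have [d [a0 [b0 [d0 aE bE ab0]]]] := laurent_normalize hv hR hres ab10.
have [[r rE]|[r rE r0]] := valuation_ring_or hv hR hres d0.
  have scale w : lmap j (lC r * w) = lC d * lmap j w by rewrite rmorphM /= lmap_lmono rE.
  by exists (lC r * a0), (lC r * b0); rewrite !toLE !scale -aE -bE.
(* With r = d^-1 in the maximal ideal, the element a0 + b0 t has trace r T' and norm r^2 N'. Both
   reduce to 0, so [norm_ker] makes both residues vanish. *)
case: ab0.
have dr : lC (j r) * lC d = 1 by rewrite rE -rmorphM /= mulVf // rmorph1.
have unscale u w : u = lC d * w -> w = lC (j r) * u.
  by move=> ->; rewrite mulrA dr mul1r.
have a0E := unscale _ _ aE; have b0E := unscale _ _ bE.
have tr0 : 2 * a0 - b0 * h' = lC r * T'.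
  apply: (lmap_inj j_inj); rewrite rmorphB !rmorphM rmorph_nat /= lmap_lmono -TE -tr1.
  rewrite -[lmono 0 (j r)]/(lC (j r)).
  by rewrite a0E b0E; move: (lmap j h') (lC (j r)) (a1) (b1) => *; ring.
have nr0 : a0 ^+ 2 - a0 * b0 * h' - b0 ^+ 2 * g' = lC r * (lC r * N').
  apply: (lmap_inj j_inj); rewrite !rmorphB rmorphXn !rmorphM /= !lmap_lmono -NE -nr1.
  rewrite -[lmono 0 (j r)]/(lC (j r)).
  by rewrite a0E b0E; move: (lmap j h') (lmap j g') (lC (j r)) (a1) (b1) => *; ring.
have kill w : lmap res (lC r * w) = 0.
  by rewrite rmorphM /= lmap_lmono r0 lmono0 mul0r.
apply: norm_ker.
  have /(congr1 (lmap res)) := tr0; rewrite kill rmorphB !rmorphM rmorph_nat /=.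
  have -> : 2 = 0 :> laurent k by rewrite -(rmorph_nat (@lC k)) k2 rmorph0.
  by rewrite mul0r sub0r => /eqP; rewrite oppr_eq0 => /eqP.
apply/eqP; rewrite -subr_eq0; apply/eqP; rewrite -[RHS](kill (lC r * N')) -nr0.
rewrite !rmorphB rmorphXn !rmorphM /=.
by move: (lmap res a0) (lmap res b0) (lmap res h') (lmap res g') => *; ring.
Qed.

Lemma normalization_quad_alg : exists t' : int_closure (toL j L),
  ic_val t' = t /\ quad_alg (ic_in (toL j L)) t' h' g'.
Proof.
have int_t : integralOver (toL j L) t.
  exists (quad_poly h' g'); first exact: quad_poly_monic.
  by rewrite /root map_quad_poly horner_quad_poly t_rel subrr.
exists (IntClosure (asboolT int_t : t \in int_closure_pred (toL j L))); split=> //.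
split=> [|[y yP]|a b].
- by apply: val_inj; rewrite /= t_rel.
- have [a [b yE]] := t_span (asboolW yP).
  by exists a, b; apply: val_inj.
- by move=> /(congr1 (@ic_val _ _ _)) /= /t_free.
Qed.

End Normalization.

(** * Optimal decompositions *)

Section Optimal.
Variables (RR : realType) (K : fieldType) (v : K -> \bar RR).
Hypothesis hv : is_rat_valuation v.

(** The map al |-> v(2^al) is additive from Q to Q with value 1 at 1; clearing the denominator of al
    shows that it is the identity. *)
Lemma rat_val_pow2 (pow2 : rat -> K) : (forall al, pow2 al != 0) ->
  (forall al be, pow2 (al + be) = pow2 al * pow2 be) -> pow2 1 = 2 -> v 2 = 1%E ->
  forall al, v (pow2 al) = (ratr al)%:E.
Proof.
move=> pow0 powD pow1 v2.
have /choice[phi phiE] : forall al, exists q : rat, v (pow2 al) = (ratr q)%:E.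
  by move=> al; apply: (rat_valE hv).
have ratr_inj : injective (@ratr RR) by exact: fmorph_inj.
have phiD al be : phi (al + be) = phi al + phi be.
  apply: ratr_inj; have := phiE (al + be).
  by rewrite powD (rat_valM hv) !phiE -EFinD -rmorphD => -[].
have phi1 : phi 1 = 1.
  by apply: ratr_inj; have := phiE 1; rewrite pow1 v2 rmorph1 => -[].
have phiB : zmod_morphism phi.
  by move=> x y; apply: (addIr (phi y)); rewrite -phiD !subrK.
pose padd := GRing.isZmodMorphism.Build rat rat phi phiB.
pose phi' : {additive rat -> rat} := HB.pack phi padd.
move=> al; rewrite phiE; congr (ratr _)%:E.
have d0 : (denq al)%:~R != 0 :> rat by rewrite intr_eq0 denq_neq0.
apply: (mulIf d0); rewrite -numqE mulrzr -[phi al *~ _](raddfMz phi').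
by rewrite -mulrzr -numqE raddfMz /= phi1.
Qed.

Variables (R : comNzRingType) (k : fieldType).
Variables (j : {rmorphism R -> K}) (res : {rmorphism R -> k}).
Hypothesis hR : forall u : K, (0 <= v u)%E <-> exists r, j r = u.
Hypothesis hres : forall r, res r = 0 <-> (0 < v (j r))%E.

Lemma lval_le_wval f h g : f = h ^+ 2 + g -> (lval v j g <= wval v j f)%E.
Proof.
move=> ->; apply: ereal_sup_ubound; exists h => //.
by rewrite addrC addKr.
Qed.

(** w(f) is only a real supremum, but below 2 optimality makes it equal to v(g), the valuation of a
    coefficient and hence rational; the alternative v(g) > 2 contradicts v(g) <= w(f). *)
Lemma optimal_gamma f h g : lval v j f = 0%E -> optimal_decomposition v j f h g ->
  lmap j g != 0 -> exists gamma : rat,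
  [/\ (ratr gamma)%:E = mine 2%:E (wval v j f), 0 <= gamma, gamma <= 2 &
      ((ratr gamma)%:E <= lval v j g)%E].
Proof.
move=> f0 [fE opt] g0.
have w0 : (0 <= wval v j f)%E.
  by rewrite -f0; apply: (@lval_le_wval f 0); rewrite expr0n add0r.
have gw := lval_le_wval fE.
have [q qE] : exists q : rat, lval v j g = (ratr q)%:E.
  have [i i0 iE] := gauss_valE hv g0; have [q qE] := rat_valE hv i0.
  by exists q; rewrite /lval iE.
have ratr2 : ratr 2 = 2 :> RR by rewrite ratr_nat.
have [w2|w2] := ltP (wval v j f) 2%:E.
  case: opt => [gE|/lt_le_trans/(_ gw)/lt_trans/(_ w2)]; last by rewrite ltxx.
  exists q; rewrite -qE; split=> //.
  - by move: w0; rewrite -gE qE lee_fin ler0q.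
  - by move: w2; rewrite -gE qE lte_fin -ratr2 ltr_rat => /ltW.
exists 2; rewrite ratr2; split=> //.
by case: opt => [->//|/ltW].
Qed.

(** With h2 = h + c s' one has f - h2^2 = c^2 (g' - h' s' - s'^2), where the second factor reduces
    to 0. Having finitely many coefficients it has positive valuation, so the inequality is
    strict. *)
Lemma residual_root_wval f h g h' g' (c : K) (q : rat) (s : laurent k) :
  (forall x : k, exists r, res r = x) ->
  f = h ^+ 2 + g -> (0 <= v c)%E -> v (c ^+ 2) = (ratr q)%:E ->
  lC c * lmap j h' = 2 * lmap j h -> lC c ^+ 2 * lmap j g' = lmap j g ->
  s ^+ 2 + lmap res h' * s = lmap res g' -> ((ratr q)%:E < wval v j f)%E.
Proof.
move=> res_surj fE /hR[rc <-] cq h'E g'E sE.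
have [s' s'E] := lmap_surj res_surj s.
pose h2 := h + lC rc * s'.
have : (lval v j (f - h2 ^+ 2) <= wval v j f)%E.
  by apply: (@lval_le_wval f h2); rewrite addrC subrK.
apply: lt_le_trans; apply/(gauss_val_gt hv) => i.
have -> : lmap j (f - h2 ^+ 2) = lC (j rc ^+ 2) * lmap j (g' - h' * s' - s' ^+ 2).
  have -> : f - h2 ^+ 2 = g - 2 * h * (lC rc * s') - (lC rc * s') ^+ 2.
    by rewrite fE /h2; move: (lC rc) => *; ring.
  rewrite !rmorphB !rmorphXn !rmorphM rmorph_nat /= -h'E -g'E !lmap_lmono.
  rewrite -[lmono 0 (j rc)]/(lC (j rc)).
  by move: (lC (j rc)) (lmap j h') (lmap j g') (lmap j s') => *; ring.
rewrite lcoef_lCM (rat_valM hv) cq lteDl //.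
have /(lmap_res_eq0 hres)/(_ i) // : lmap res (g' - h' * s' - s' ^+ 2) = 0.
by rewrite !rmorphB rmorphXn rmorphM /= s'E -sE; move: (lmap res h') => *; ring.
Qed.

End Optimal.

(** * The normalization and its special fibre in the three cases *)

Theorem proposition3p3p2
  (RR : realType)
  (R1 : idomainType) (K : closedFieldType)
  (iota : {rmorphism {fraction R1} -> K})
  (v : K -> \bar RR) (pow2 : rat -> K)
  (k : closedFieldType) (res : {rmorphism 'O_iota -> k})
  (L : fieldExtType {fraction {poly K}}) (z : L)
  (f h g : laurent 'O_iota) :
  let j : {rmorphism 'O_iota -> K} := @ic_val R1 K (iota \o @tofrac R1) in
  let mm : set 'O_iota := [set r | (0 < v (j r))%E]%classic in
  complete_dvr R1 ->
  [pchar {fraction R1}] =i pred0 ->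
  (2 : R1) \isn't a GRing.unit ->
  (forall u : K, algebraicOver iota u) ->
  is_rat_valuation v ->
  v 2 = 1%E ->
  (forall u : K, (0 <= v u)%E <-> integralOver (iota \o @tofrac R1) u) ->
  (forall al, pow2 al != 0) ->
  (forall al be, pow2 (al + be) = pow2 al * pow2 be) ->
  pow2 1 = 2 ->
  (forall c : k, exists r, res r = c) ->
  (forall r, res r = 0 <-> mm r) ->
  lval v j f = 0%E ->
  ~ (exists p : laurent K, lmap j f = p ^+ 2) ->
  (forall p q : laurent K, lmap j f = p ^+ 2 * q -> exists p', p * p' = 1) ->
  z ^+ 2 = toL j L f ->
  <<1; z>>%VS = fullv ->
  optimal_decomposition v j f h g ->
  let w := wval v j f in
  exists (gamma : rat) (h' g' dg' : laurent 'O_iota),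
  [/\ (ratr gamma)%:E = mine 2%:E w,
      lscaled j (pow2 (1 - gamma / 2)) h h',
      lscaled j (pow2 gamma)^-1 g g',
      lscaled j (pow2 gamma)^-1 (lderiv g) dg' &
  forall t : L,
  z = toL j L h + (lfrac (lC (pow2 (gamma / 2))))%:A * t ->
  let N := int_closure (toL j L) in
  let B := model h' g' in
  let C := model_fiber mm h' g' in
  [/\ toL j L h' * t + t ^+ 2 = toL j L g',
      flat (@ic_in _ _ (toL j L) \o @lC 'O_iota),
      exists phi : {rmorphism B -> N},
        [/\ bijective phi,
            forall c, phi (model_in h' g' c) = ic_in (toL j L) c &
            ic_val (phi (model_T h' g')) = t] &
      exists2 sigma : {rmorphism laurent k -> C},
        (forall c, sigma (lmap res c) = fiber_in mm h' g' c) &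
      let kappa : {rmorphism k -> C} := sigma \o @lC k in
      let eqn_mod_m := map_poly (lmap res) (quad_poly h' g') in
      [/\ (w < 2%:E)%E ->
            [/\ eqn_mod_m = 'X^2 - (lmap res g')%:P,
                irreducible [set: spec C]%classic,
                smooth_outside_finite_zeros kappa (sigma (lmap res dg')) &
                purely_inseparable_double_covering sigma],
          w = 2%:E ->
            [/\ exists2 g4, lscaled j 4^-1 g g4 &
                  eqn_mod_m = 'X^2 + (lmap res h)%:P * 'X - (lmap res g4)%:P,
                irreducible [set: spec C]%classic,
                smooth_outside_finite_zeros kappa (sigma (lmap res f)) &
                separable_double_covering sigma] &
          (2%:E < w)%E ->
            [/\ eqn_mod_m = ((lmap res h)%:P + 'X) * 'X,
                smooth_outside_finite_zeros kappa (sigma (lmap res f)) &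
                exists P1 P2 : spec C,
                  [/\ two_rational_curves sigma P1 P2,
                      component_iso sigma P1 & component_iso sigma P2]]]]].
Proof.
move=> j mm _ _ _ _ hv v2 hint pow0 powD pow1 res_surj res_ker f0 f_nsq f_sqf zE zgen opt w.
have j_inj : injective j by exact: val_inj.
have hR u : (0 <= v u)%E <-> exists r, j r = u.
  split=> [/hint/asboolT uP|[r <-]]; first by exists (IntClosure (uP : u \in int_closure_pred (iota \o @tofrac R1))).
  by apply/hint; case: r => r rP; apply: asboolW rP.
have hres r : res r = 0 <-> (0 < v (j r))%E by apply: res_ker.
have vpow := rat_val_pow2 hv pow0 powD pow1 v2.
have K2 : 2 != 0 :> K.
  by apply/eqP => K20; have := v2; rewrite K20 (rat_val0 hv).
have k2 : 2 = 0 :> k.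
  by rewrite -(rmorph_nat res); apply/hres; rewrite rmorph_nat v2 lte_fin.
have pow00 : pow2 0 = 1.
  by apply: (mulfI (pow0 0)); rewrite -powD addr0 mulr1.
have [fE optg] := opt.
have g0 : lmap j g != 0.
  by apply/eqP => g0; apply: f_nsq; exists (lmap j h); rewrite fE rmorphD rmorphXn /= g0 addr0.
have [gamma [gamE gam0 gam2 gamg]] := optimal_gamma hv f0 opt g0.
(* [h'] is integral because gamma <= 2, and [g'] below because gamma <= v(g). *)
have [h' h'E] : exists h', lmap j h' = lC (pow2 (1 - gamma / 2)) * lmap j h.
  apply: (laurent_integral_lift hR) => i; rewrite lcoef_lCM (rat_valM hv) vpow.
  apply: adde_ge0; last by rewrite lcoef_lmap; apply/hR; exists (lcoef i h).
  by rewrite lee_fin ler0q subr_ge0 ler_pdivrMr // mul1r.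
have vgV : v (pow2 gamma)^-1 = (- ratr gamma)%:E by apply: rat_valV.
have [g' g'E] : exists g', lmap j g' = lC (pow2 gamma)^-1 * lmap j g.
  apply: (laurent_integral_lift hR) => i; rewrite lcoef_lCM (rat_valM hv) vgV.
  have := proj1 (gauss_val_ge v (ratr gamma)%:E (lmap j g)) gamg i.
  by rewrite EFinN addeC sube_ge0 ?fin_numE.
exists gamma, h', g', (lderiv g'); split=> //.
  by rewrite /lscaled !lmap_lderiv g'E lderivM lderivC mul0r add0r.
move=> t ztE N B C.
pose c := pow2 (gamma / 2).
have cc : c ^+ 2 = pow2 gamma by rewrite expr2 -powD -splitr.
have vc : v c = (ratr (gamma / 2))%:E by apply: vpow.
have ch' : lC c * lmap j h' = 2 * lmap j h.
  have c2 : c * pow2 (1 - gamma / 2) = 2 by rewrite -powD addrC subrK pow1.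
  by rewrite h'E mulrA -rmorphM /= c2; congr (_ * _); apply: (rmorph_nat (@lC K) 2).
have cg' : lC c ^+ 2 * lmap j g' = lmap j g.
  by rewrite g'E mulrA -rmorphXn -rmorphM /= cc divff // rmorph1 mul1r.
(* For w <= 2 gamma equals w, so a residual root would yield w < w. *)
have noroot : (w <= 2%:E)%E -> forall s : laurent k,
    s ^+ 2 + lmap res h' * s != lmap res g'.
  move=> w2 s; apply/eqP => sE.
  have := @residual_root_wval _ _ _ hv _ _ _ _ hR hres f h g h' g' c gamma s res_surj fE.
  rewrite cc vpow gamE => /(_ _ erefl ch' cg' sE).
  have -> : mine 2%:E (wval v j f) = w by apply/min_idPr.
  by rewrite ltxx => /(_ _)/negP; apply => //; rewrite vc lee_fin ler0q divr_ge0.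
have h'0 : (w < 2%:E)%E -> lmap res h' = 0.
  move=> w2; apply/(lmap_res_eq0 hres) => i; rewrite h'E lcoef_lCM (rat_valM hv) vpow.
  apply: (@lt_le_trans _ _ (ratr (1 - gamma / 2))%:E).
    rewrite lte_fin ltr0q subr_gt0 ltr_pdivrMr // mul1r -(ltr_rat RR) ratr_nat -lte_fin gamE.
    by rewrite gt_min w2 orbT.
  by rewrite leeDl // lcoef_lmap; apply/hR; exists (lcoef i h).
have gam2E : (2%:E <= w)%E -> gamma = 2.
  have ratr2 : ratr 2 = 2 :> RR by rewrite ratr_nat.
  move=> w2; apply: (fmorph_inj (@ratr RR)); rewrite /= ratr2.
  have : (ratr gamma)%:E = 2%:E :> \bar RR by rewrite gamE; apply/min_idPl.
  by case.
have h'h : (2%:E <= w)%E -> h' = h.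
  move=> /gam2E gE; apply: (lmap_inj j_inj).
  by rewrite h'E gE divff // subrr pow00 rmorph1 mul1r.
have res_f : (2%:E <= w)%E -> lmap res f = lmap res h ^+ 2.
  move=> /gam2E gE; rewrite fE rmorphD rmorphXn /=.
  suff -> : lmap res g = 0 by rewrite addr0.
  apply/(lmap_res_eq0 hres) => i.
  have := proj1 (gauss_val_ge v (ratr gamma)%:E (lmap j g)) gamg i.
  by apply: lt_le_trans; rewrite gE ratr_nat lte_fin.
have res_f0 : lmap res f != 0.
  apply/eqP => /(lmap_res_eq0 hres) fpos.
  by have := proj2 (gauss_val_gt hv 0 (lmap j f)) fpos; rewrite -/(lval v j f) f0 ltxx.
have res_h0 : (2%:E <= w)%E -> lmap res h != 0.
  by move=> /res_f fh; apply: contra_neq res_f0 => h0; rewrite fh h0 expr0n.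
(* For w >= 2 the factor [h'] = [h] is nonzero, so b = 0 and then a = 0. For w < 2 a nonzero b would
   make [g'] a square, against [noroot]. *)
have norm_ker (a b : laurent k) : b * lmap res h' = 0 ->
    a ^+ 2 = a * b * lmap res h' + b ^+ 2 * lmap res g' -> a = 0 /\ b = 0.
  have sq0 (d : laurent k) : d ^+ 2 = 0 -> d = 0 by rewrite expr2 => /laurent_eq0[].
  have [w2|w2] := ltP w 2%:E; last first.
    rewrite (h'h w2) => /laurent_eq0[->|h0].
      by rewrite mulr0 mul0r expr0n mul0r addr0 => /sq0.
    by have := res_h0 w2; rewrite h0 eqxx.
  rewrite (h'0 w2) => _; rewrite mulr0 add0r => ab.
  have [b0|b0] := eqVneq b 0.
    by split=> //; apply: sq0; rewrite ab b0 expr0n mul0r.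
  have [s sE] := laurent_quotient_sqrt b0 ab.
  by have := noroot (ltW w2) s; rewrite (h'0 w2) mul0r addr0 -sE eqxx.
have t_rel' := @t_rel _ _ j L z t f g h g' h' c zE fE (pow0 _) ch' cg' ztE.
have [t' [t'E QN]] := @normalization_quad_alg _ _ v _ _ j res hv j_inj hR hres K2 k2 L z t
  f g h g' h' c f_nsq f_sqf zE zgen fE (pow0 _) ch' cg' ztE norm_ker.
have [sigma [sigmaE QC]] := fiber_quad_alg h' g' res_surj res_ker.
have dg'E : lmap res (lderiv g') = lderiv (lmap res g') by rewrite lmap_lderiv.
split.
- by rewrite addrC.
- exact: quad_alg_flat QN.
- have [phi [phi_bij phiA phit]] := quad_alg_iso (quad_alg_qpoly h' g') QN.
  by exists phi; split=> //; rewrite -t'E -phit.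
have eqnE : map_poly (lmap res) (quad_poly h' g') =
  quad_poly (lmap res h') (lmap res g') by apply: map_quad_poly.
exists sigma => //=; rewrite eqnE; split=> w2.
- rewrite (h'0 w2) in QC *.
  have nr (b : laurent k) : b ^+ 2 + 0 * b != lmap res g'.
    by rewrite -(h'0 w2); apply/noroot/ltW.
  split.
  + by rewrite /quad_poly polyC0 mul0r addr0.
  + exact: quad_alg_irreducible QC nr.
  + apply: (smooth_outside_of_formally_smooth QC).
      (* A vanishing derivative would make [g'] a square and so give a root of the reduced
         equation. *)
      rewrite dg'E; apply/eqP => /(lderiv_eq0_square k2)[s sE].
      by have := nr s; rewrite mul0r addr0 sE eqxx.
    by rewrite dg'E; apply: (formally_smooth_insep QC).
  + exact: quad_alg_purely_inseparable QC nr k2 erefl.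
- have w2' : (2%:E <= w)%E by rewrite w2.
  have h'r : lmap res h' = lmap res h by rewrite (h'h w2').
  rewrite h'r in QC *.
  have nr (b : laurent k) : b ^+ 2 + lmap res h * b != lmap res g'.
    by rewrite -h'r; apply: noroot; rewrite w2.
  split.
  + exists g'; last first.
      rewrite /quad_poly.
      reflexivity.
    have pow4 : pow2 2 = 4.
      have -> : 2 = 1 + 1 :> rat by [].
      by rewrite powD pow1 -natrM.
    by rewrite /lscaled g'E (gam2E w2') pow4.
  + exact: quad_alg_irreducible QC nr.
  + have fs := formally_smooth_lin QC k2 (res_f w2').
    have so := smooth_outside_of_formally_smooth QC res_f0 fs.
    exact so.
  + exact: (quad_alg_separable QC nr k2 (res_h0 w2')).
- have w2' : (2%:E <= w)%E by apply: ltW.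
  (* Both alternatives of optimality give v(g) > 2, so g/4 reduces to 0. *)
  have g'0 : lmap res g' = 0.
    apply/(lmap_res_eq0 hres) => i; rewrite g'E lcoef_lCM (rat_valM hv) vgV (gam2E w2').
    have : (2%:E < lval v j g)%E by case: optg => [->|].
    move=> /(gauss_val_gt hv)/(_ i).
    by rewrite ratr_nat EFinN addeC sube_gt0.
  have h'r : lmap res h' = lmap res h by rewrite (h'h w2').
  rewrite h'r in QC *.
  split.
  + by rewrite g'0 /quad_poly polyC0 subr0 mulrDl addrC.
  + have fs := formally_smooth_lin QC k2 (res_f w2').
    have so := smooth_outside_of_formally_smooth QC res_f0 fs.
    exact so.
  + exact: (split_two_curves QC g'0 (res_h0 w2')).
Qed.
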